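(* Let $G$ be a finite abelian group and $\mathbb{F}$ a field. Let $\mathcal{A}=\mathrm{M}_{x_0}\otimes\bigotimes_{i=1}^\infty\mathrm{M}_{a_i}$ and $\mathcal{A}'=\mathrm{M}_{x'_0}\otimes\bigotimes_{i=1}^\infty\mathrm{M}_{a'_i}$ be in standard form, with $\operatorname{supp}(a_i)=S$ and $\operatorname{supp}(a'_i)=S'$ for all $i\ge1$. Then $\mathcal{A}\cong\mathcal{A}'$ as $G$-graded algebras if and only if $S=S'$ and there exist elements $b,b'\in\mathbb{Z}_{\ge0}G$ with $\operatorname{supp}(b)=\operatorname{supp}(b')=S$ satisfying $b\bar{x}_0=b'\bar{x}'_0$ and $bK^+(\mathcal{A})=b'K^+(\mathcal{A}')$.
   Context: All algebras are associative and unital over $\mathbb{F}$. A $G$-grading on $\mathcal{A}$ is a decomposition $\mathcal{A}=\bigoplus_{g\in G}\mathcal{A}_g$ into subspaces with $\mathcal{A}_g\mathcal{A}_h\subseteq\mathcal{A}_{gh}$; homomorphisms of graded algebras preserve components, and $\cong$ means isomorphism of graded algebras. **Matrix algebras.** For $0\ne x=\sum_g x_g g\in\mathbb{Z}_{\ge0}G$, let $n=\sum_g x_g$ and choose $(g_1,\dots,g_n)\in G^n$ in which each $g$ occurs $x_g$ times. $\mathrm{M}_x$ is $\mathrm{M}_n(\mathbb{F})$ with the (elementary) grading in which the matrix unit $E_{ij}$ has degree $g_ig_j^{-1}$; it is well defined up to graded isomorphism. Tensor products are graded by $\deg(a\otimes b)=\deg a\deg b$, and $\mathrm{M}_x\otimes\mathrm{M}_y\cong\mathrm{M}_{xy}$.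 **Infinite products.** For nonzero $x_0,a_1,a_2,\ldots\in\mathbb{Z}_{\ge0}G$, $\mathrm{M}_{x_0}\otimes\bigotimes_{i=1}^\infty\mathrm{M}_{a_i}$ denotes the direct limit of $\mathrm{M}_{x_0}\to\mathrm{M}_{x_1}\to\mathrm{M}_{x_2}\to\cdots$, where $x_i=x_0a_1\cdots a_i$ and $\mathrm{M}_{x_{i-1}}\to\mathrm{M}_{x_{i-1}}\otimes\mathrm{M}_{a_i}\cong\mathrm{M}_{x_i}$ is $z\mapsto z\otimes1$. **Idempotents and supp.** Let $\Gamma=\mathrm{Gal}(\overline{\mathbb{Q}}/\mathbb{Q})$ act on $\hat G=\mathrm{Hom}(G,\overline{\mathbb{Q}}^\times)$ by post-composition. For an orbit $j\in\hat G/\Gamma$ put $e_j=\sum_{\chi\in j}e_\chi\in\mathbb{Q}G$, where $e_\chi=\frac1{|G|}\sum_{g\in G}\chi(g)^{-1}g$, and $\mathbb{L}_j=e_j\mathbb{Q}G$ (a field); then $\mathbb{Q}G=\prod_j\mathbb{L}_j$. For $S\subseteq\hat G/\Gamma$ let $\mathbb{L}_S=\prod_{j\in S}\mathbb{L}_j$, an ideal of $\mathbb{Q}G$ and a ring with identity $\sum_{j\in S}e_j$, and let $\pi_S:\mathbb{Q}G\to\mathbb{L}_S$, $\pi_S(z)=\sum_{j\in S}e_jz$. For $z\in\mathbb{Q}G$, $\operatorname{supp}(z)=\{j\in\hat G/\Gamma\mid e_jz\neq0\}$. For $z=\sum_g z_gg$, $\bar z=\sum_g z_gg^{-1}$; one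 has $\operatorname{supp}(\bar z)=\operatorname{supp}(z)$. **Standard form.** $\mathrm{M}_{x_0}\otimes\bigotimes_{i=1}^\infty\mathrm{M}_{a_i}$ is in standard form if $\operatorname{supp}(a_i)$ is a fixed set $S$ independent of $i\ge1$ and $\operatorname{supp}(x_0)\subseteq S$. **$K^+$.** For $\mathcal{A}$ in standard form let $b_i=\prod_{k=1}^i\bar a_k$; each $\pi_S(b_i)$ is invertible in $\mathbb{L}_S$. Define $$K^+(\mathcal{A})=\bigcup_{i=1}^\infty\frac1{\pi_S(b_i)}\pi_S(\mathbb{Z}_{\ge0}G)\subseteq\mathbb{L}_S,$$ on which elements of $\mathbb{Z}_{\ge0}G$ act by multiplication in $\mathbb{Q}G$. $K^+(\mathcal{A}')$ is defined in the same way from $a'_i$ and $S'$. *)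

(* Defs.v *)
From HB Require Import structures.
From mathcomp Require Import all_boot all_order all_algebra all_fingroup all_solvable.
From mathcomp Require Import all_field all_character.
From mathcomp Require Import boolp classical_sets mxtens.

Set Implicit Arguments.
Unset Strict Implicit.
Unset Printing Implicit Defensive.

Import GRing.Theory.
Local Open Scope ring_scope.

(* The group (semi)algebra R[G], G being the whole of gT, as functions gT -> R
   with the convolution product. *)
Definition grpalg (R : Type) (gT : finGroupType) := {ffun gT -> R}.

HB.instance Definition _ (R : nmodType) (gT : finGroupType) :=
  GRing.Nmodule.on (grpalg R gT).
HB.instance Definition _ (R : zmodType) (gT : finGroupType) :=
  GRing.Zmodule.on (grpalg R gT).

Section GroupAlgebra.

Variables (R : pzSemiRingType) (gT : finGroupType).
Implicit Types x y z : grpalg R gT.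

Definition grpalg_one : grpalg R gT := [ffun g => (g == 1%g)%:R].

Definition grpalg_mul x y : grpalg R gT :=
  [ffun g => \sum_(h : gT) x h * y (h^-1 * g)%g].

Lemma grpalg_mulA : associative grpalg_mul.
Proof.
move=> x y z; apply/ffunP=> g; rewrite !ffunE.
under eq_bigr do rewrite ffunE mulr_sumr.
under [RHS]eq_bigr do rewrite ffunE mulr_suml.
rewrite [RHS]exchange_big /=; apply: eq_bigr => h _.
rewrite (reindex_inj (mulgI h^-1%g)) /=; apply: eq_bigr => k _.
by rewrite mulrA invMg invgK -!mulgA mulKVg.
Qed.

Lemma grpalg_mul1 : left_id grpalg_one grpalg_mul.
Proof.
move=> x; apply/ffunP=> g; rewrite ffunE (bigD1 1%g) //= big1 => [|h /negPf h1].
  by rewrite ffunE eqxx mul1r invg1 mul1g addr0.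
by rewrite ffunE h1 mul0r.
Qed.

Lemma grpalg_mulr1 : right_id grpalg_one grpalg_mul.
Proof.
move=> x; apply/ffunP=> g; rewrite ffunE (bigD1 g) //= big1 => [|h hg].
  by rewrite ffunE mulVg eqxx mulr1 addr0.
by rewrite ffunE -eq_mulVg1 (negPf hg) mulr0.
Qed.

Lemma grpalg_mulDl : left_distributive grpalg_mul +%R.
Proof.
move=> x y z; apply/ffunP=> g; rewrite !ffunE -big_split /=.
by apply: eq_bigr => h _; rewrite ffunE mulrDl.
Qed.

Lemma grpalg_mulDr : right_distributive grpalg_mul +%R.
Proof.
move=> x y z; apply/ffunP=> g; rewrite !ffunE -big_split /=.
by apply: eq_bigr => h _; rewrite ffunE mulrDr.
Qed.

Lemma grpalg_mul0 : left_zero 0 grpalg_mul.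
Proof.
by move=> x; apply/ffunP=> g; rewrite !ffunE big1 // => h _; rewrite ffunE mul0r.
Qed.

Lemma grpalg_mulr0 : right_zero 0 grpalg_mul.
Proof.
by move=> x; apply/ffunP=> g; rewrite !ffunE big1 // => h _; rewrite ffunE mulr0.
Qed.

HB.instance Definition _ := GRing.Nmodule_isPzSemiRing.Build (grpalg R gT)
  grpalg_mulA grpalg_mul1 grpalg_mulr1 grpalg_mulDl grpalg_mulDr
  grpalg_mul0 grpalg_mulr0.

Lemma grpalg_mulE x y g : (x * y) g = \sum_(h : gT) x h * y (h^-1 * g)%g.
Proof. exact: ffunE. Qed.

Definition bar x : grpalg R gT := [ffun g => x g^-1%g].

End GroupAlgebra.

Lemma grpalg_oner_neq0 (R : nzSemiRingType) gT : 1 != 0 :> grpalg R gT.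
Proof. by apply/eqP => /ffunP/(_ 1%g)/eqP; rewrite !ffunE eqxx oner_eq0. Qed.

HB.instance Definition _ (R : nzSemiRingType) (gT : finGroupType) :=
  GRing.PzSemiRing_isNonZero.Build (grpalg R gT) (@grpalg_oner_neq0 R gT).


(* The dual group Hom(G, Qbar^x): a multiplicative map sending 1 to 1 takes nonzero
   values. *)
Definition is_gchar (gT : finGroupType) (chi : {ffun gT -> algC}) :=
  (chi 1%g == 1) && [forall g, forall h, chi (g * h)%g == chi g * chi h].

Record gdual (gT : finGroupType) :=
  GDual { gdual_fun :> {ffun gT -> algC}; _ : is_gchar gdual_fun }.

HB.instance Definition _ gT := [isSub for @gdual_fun gT].
HB.instance Definition _ gT := [Countable of gdual gT by <:].

Section DualFinite.

Variable gT : finGroupType.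
Implicit Type chi : gdual gT.

Lemma gdual1 chi : chi 1%g = 1.
Proof. by case: chi => f /= /andP[/eqP]. Qed.

Lemma gdualM chi g h : chi (g * h)%g = chi g * chi h.
Proof. by case: chi => f /= /andP[_ /forallP/(_ g)/forallP/(_ h)/eqP]. Qed.

Lemma gdualX chi g n : chi (g ^+ n)%g = chi g ^+ n.
Proof.
elim: n => [|n IHn]; first by rewrite expg0 expr0 gdual1.
by rewrite expgS exprS gdualM IHn.
Qed.

Lemma gdual_unity chi g : chi g ^+ #|gT| = 1.
Proof. by rewrite -gdualX -cardsT expg_cardG ?inE // gdual1. Qed.

Lemma gdualV chi g : chi g^-1%g = (chi g)^-1.
Proof.
have chiVM : chi g^-1%g * chi g = 1 by rewrite -gdualM mulVg gdual1.
apply: (mulIf (x := chi g)); last rewrite chiVM mulVf //.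
all: by apply/eqP => chig0; move/eqP: chiVM; rewrite chig0 mulr0 eq_sym oner_eq0.
Qed.

Let card_gt0 : (0 < #|gT|)%N. Proof. by apply/card_gt0P; exists 1%g. Qed.
Let z := sval (C_prim_root_exists card_gt0).
Let z_prim : #|gT|.-primitive_root z := svalP (C_prim_root_exists card_gt0).

Definition gdual_code chi : {ffun gT -> 'I_#|gT|} :=
  [ffun g => sval (prim_rootP z_prim (gdual_unity chi g))].

Definition gdual_decode (u : {ffun gT -> 'I_#|gT|}) : option (gdual gT) :=
  insub [ffun g => z ^+ u g].

Lemma gdual_codeK : pcancel gdual_code gdual_decode.
Proof.
move=> chi; rewrite /gdual_decode.
suff -> : [ffun g => z ^+ gdual_code chi g] = val chi by rewrite valK.
apply/ffunP=> g; rewrite !ffunE.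
by case: (prim_rootP _ _) => /= i <-.
Qed.

HB.instance Definition _ : isFinite (gdual gT) := PCanIsFinite gdual_codeK.

End DualFinite.

(* The orbit of chi under Gal(Qbar / Q); every ring endomorphism of algC is
   bijective (algC_autK, algC_invautK). *)
Definition gal_orbit (gT : finGroupType) (chi : gdual gT) : {set gdual gT} :=
  [set psi : gdual gT | `[< exists nu : {rmorphism algC -> algC},
                              forall g, psi g = nu (chi g) >]].

(* (dual of G) / Gamma; an orbit is a set of characters. *)
Definition gal_orbits (gT : finGroupType) : {set {set gdual gT}} :=
  [set gal_orbit chi | chi : gdual gT].

Definition char_idem (gT : finGroupType) (chi : gdual gT) : grpalg algC gT :=
  [ffun g => #|gT|%:R^-1 * (chi g)^-1].

(* e_j in Q[G]; its coefficients, computed in algC, are rational for every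
   orbit j (orbit_idemE below). *)
Definition orbit_idem (gT : finGroupType) (j : {set gdual gT}) :
  grpalg rat gT := [ffun g => getCrat (\sum_(chi in j) char_idem chi g)].

Section OrbitIdem.

Variable gT : finGroupType.
Implicit Types (chi : gdual gT) (j : {set gdual gT}).

Lemma gdual_aut_subproof (nu : {rmorphism algC -> algC}) chi :
  is_gchar [ffun g => nu (chi g)].
Proof.
apply/andP; split; first by rewrite ffunE gdual1 rmorph1.
by apply/forallP=> g; apply/forallP=> h; rewrite !ffunE gdualM rmorphM.
Qed.

Definition gdual_aut nu chi : gdual gT := GDual (gdual_aut_subproof nu chi).

Lemma gdual_aut_inj nu : injective (gdual_aut nu).
Proof.
move=> chi psi /(congr1 val)/ffunP nu_eq; apply/val_inj/ffunP=> g.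
by have:= nu_eq g; rewrite !ffunE => /fmorph_inj.
Qed.

Lemma gal_orbit_aut nu chi0 chi :
  (gdual_aut nu chi \in gal_orbit chi0) = (chi \in gal_orbit chi0).
Proof.
rewrite !inE; apply/asboolP/asboolP => -[mu Dmu].
  exists (algC_invaut nu \o mu : {rmorphism algC -> algC}) => g /=.
  by rewrite -Dmu ffunE algC_autK.
by exists (nu \o mu : {rmorphism algC -> algC}) => g /=; rewrite ffunE Dmu.
Qed.

Lemma orbit_sum_aut (nu : {rmorphism algC -> algC}) j g : j \in gal_orbits gT ->
  nu (\sum_(chi in j) char_idem chi g) = \sum_(chi in j) char_idem chi g.
Proof.
case/imsetP=> chi0 _ ->; rewrite [RHS](reindex_inj (@gdual_aut_inj nu)) rmorph_sum.
apply: eq_big => [chi | chi _]; first by rewrite gal_orbit_aut.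
by rewrite !ffunE rmorphM !fmorphV rmorph_nat.
Qed.

Lemma orbit_sum_Crat j g : j \in gal_orbits gT ->
  \sum_(chi in j) char_idem chi g \in Crat.
Proof.
move=> jP; set c := \sum_(chi in j) _.
have [Qn galQn [QnC gQnC [w [w_prim _] _]]] :=
  group_num_field_exists [set: gT]%G.
have wC_prim: #|gT|.-primitive_root (QnC w).
  by rewrite fmorph_primitive_root -cardsT.
have [a Da]: exists a, QnC a = c.
  have chiP (chi : gdual gT) : {b | QnC b = chi g}.
    have [i ->] := prim_rootP wC_prim (gdual_unity chi g).
    by exists (w ^+ i); rewrite rmorphXn.
  exists (\sum_(chi in j) #|gT|%:R^-1 * (sval (chiP chi))^-1).
  rewrite rmorph_sum; apply: eq_bigr => chi _.
  by rewrite ffunE rmorphM !fmorphV rmorph_nat; case: (chiP chi) => b /= ->.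
suff /vlineP[q Dq]: a \in 1%VS.
  by rewrite -Da Dq alg_num_field fmorph_rat Crat_rat.
rewrite -[1%VS]/(asval 1%AS) -(galois_fixedField galQn).
apply/fixedFieldP=> [|s sG]; first exact: memvf.
have [nu Dnu] := gQnC s; apply: (fmorph_inj QnC).
by rewrite Dnu Da orbit_sum_aut.
Qed.

Lemma orbit_idemE j g : j \in gal_orbits gT ->
  ratr (orbit_idem j g) = \sum_(chi in j) char_idem chi g.
Proof. by move=> jP; rewrite ffunE getCratK ?orbit_sum_Crat. Qed.

End OrbitIdem.

Definition ratG (gT : finGroupType) (x : grpalg nat gT) : grpalg rat gT :=
  [ffun g => (x g)%:R].

Definition supp (gT : finGroupType) (z : grpalg rat gT) : {set {set gdual gT}} :=
  [set j in gal_orbits gT | orbit_idem j * z != 0].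

Section LS.

Variables (gT : finGroupType) (S : {set {set gdual gT}}).

Local Open Scope classical_set_scope.

(* L_S, the product of the fields L_j = e_j Q[G], j \in S, as an ideal of
   Q[G]. *)
Definition LS : set (grpalg rat gT) :=
  [set z | exists w : {set gdual gT} -> grpalg rat gT,
             z = \sum_(j in S) orbit_idem j * w j].

Definition LS_one : grpalg rat gT := \sum_(j in S) orbit_idem j.

Definition LS_proj (z : grpalg rat gT) : grpalg rat gT :=
  \sum_(j in S) orbit_idem j * z.

Definition LS_inverse (z u : grpalg rat gT) := LS u /\ u * z = LS_one.

(* With a : nat -> Z_{>=0}[G] listing a_1, a_2, ... from index 0, this is
   b_(i+1) = bar a_1 ... bar a_(i+1). *)
Definition bprod (a : nat -> grpalg nat gT) (i : nat) : grpalg nat gT :=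
  \prod_(k < i.+1) bar (a k).

Definition Kplus (a : nat -> grpalg nat gT) : set (grpalg rat gT) :=
  [set y | exists i c u, LS_inverse (LS_proj (ratG (bprod a i))) u /\
                         y = u * LS_proj (ratG c)].

End LS.

Definition standard_form (gT : finGroupType) (x0 : grpalg nat gT)
    (a : nat -> grpalg nat gT) (S : {set {set gdual gT}}) :=
  (forall i, supp (ratG (a i)) = S) /\ supp (ratG x0) \subset S.

Record is_grading (F : fieldType) (gT : finGroupType) (A : algType F)
    (comp : gT -> set A) : Prop := IsGrading {
  grading0 : forall g, comp g 0;
  gradingP : forall g c x y, comp g x -> comp g y -> comp g (c *: x + y);
  gradingM : forall g h x y, comp g x -> comp h y -> comp (g * h)%g (x * y);
  grading_sum : forall x, exists2 p : gT -> A,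
    forall g, comp g (p g) & x = \sum_(g : gT) p g;
  grading_free : forall p : gT -> A, (forall g, comp g (p g)) ->
    \sum_(g : gT) p g = 0 -> forall g, p g = 0
}.

Record gradedAlg (F : fieldType) (gT : finGroupType) := GradedAlg {
  galg :> algType F;
  gcomp : gT -> set galg;
  gcompP : is_grading gcomp
}.

Record gradedHom (F : fieldType) (gT : finGroupType) (A B : gradedAlg F gT) :=
  GradedHom {
    ghom :> {lrmorphism A -> B};
    ghomP : forall g x, gcomp g x -> gcomp g (ghom x)
  }.

Definition graded_iso (F : fieldType) (gT : finGroupType)
    (A B : gradedAlg F gT) :=
  exists (f : gradedHom A B) (f' : gradedHom B A), cancel f f' /\ cancel f' f.

(* Direct limit of a sequence of algebras A 0 -> A 1 -> ... : disjoint union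
   modulo eventual equality. *)
Section DirectLimit.

Local Notation repr := generic_quotient.repr.

Variables (F : fieldType) (A : nat -> algType F).
Variable f : forall n, {lrmorphism A n -> A n.+1}.

(* The composite A m -> A k for m <= k (and 0 for k < m, never used). *)
Fixpoint dtrans m (x : A m) k : A k :=
  match m =P k with
  | ReflectT e => ecast n (A n) e x
  | ReflectF _ =>
      match k return A k with 0 => 0 | k'.+1 => f k' (dtrans x k') end
  end.

Lemma dtrans_id m (x : A m) : dtrans x m = x.
Proof. by case: m x => [|m] x /=; case: eqP => // e; rewrite eq_axiomK. Qed.

Lemma dtransS m (x : A m) k : (m <= k)%N -> dtrans x k.+1 = f k (dtrans x k).
Proof. by move=> lemk /=; case: eqP => // Dm; exfalso; rewrite Dm ltnn in lemk. Qed.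

Lemma dtrans_trans m (x : A m) k l : (m <= k <= l)%N ->
  dtrans (dtrans x k) l = dtrans x l.
Proof.
case/andP=> lemk; elim: l => [|l IHl].
  by rewrite leqn0 => /eqP k0; subst k; rewrite dtrans_id.
rewrite leq_eqVlt => /predU1P[Dk|]; last first.
  by rewrite ltnS => lekl; rewrite !dtransS ?IHl // (leq_trans lemk).
by case: _ / Dk; rewrite dtrans_id.
Qed.

Lemma dtrans_op2 (o : forall k, A k -> A k -> A k) :
  (forall k x y, f k (o k x y) = o k.+1 (f k x) (f k y)) ->
  forall m k (x y : A m), (m <= k)%N ->
    dtrans (o m x y) k = o k (dtrans x k) (dtrans y k).
Proof.
move=> fo m k x y; elim: k => [|k IHk].
  by rewrite leqn0 => /eqP m0; subst m; rewrite !dtrans_id.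
rewrite leq_eqVlt => /predU1P[Dk|lemk]; first by subst m; rewrite !dtrans_id.
by rewrite !dtransS // IHk // fo.
Qed.

Lemma dtrans_op1 (o : forall k, A k -> A k) :
  (forall k x, f k (o k x) = o k.+1 (f k x)) ->
  forall m k (x : A m), (m <= k)%N -> dtrans (o m x) k = o k (dtrans x k).
Proof.
by move=> fo m k x; apply: (dtrans_op2 (o := fun k x _ => o k x)) => // *.
Qed.

Lemma dtrans_op0 (o : forall k, A k) : (forall k, f k (o k) = o k.+1) ->
  forall m k, (m <= k)%N -> dtrans (o m) k = o k.
Proof. by move=> fo m k; apply: (dtrans_op1 (o := fun k _ => o k)) => // *. Qed.

Definition dunion := {n : nat & A n}.
HB.instance Definition _ := Choice.on dunion.

Definition deqv (u v : dunion) :=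
  `[< exists k, [/\ tag u <= k, tag v <= k
                  & dtrans (tagged u) k = dtrans (tagged v) k]%N >].

Lemma deqv_refl : reflexive deqv.
Proof. by move=> u; apply/asboolP; exists (tag u). Qed.

Lemma deqv_sym : symmetric deqv.
Proof.
by move=> u v; apply/asboolP/asboolP => -[k [? ? ?]]; exists k.
Qed.

Lemma deqv_trans : transitive deqv.
Proof.
move=> v u w /asboolP[k [uk vk Euv]] /asboolP[l [vl wl Evw]].
apply/asboolP; exists (maxn k l); rewrite !leq_max uk wl orbT; split=> //.
rewrite -(@dtrans_trans _ _ k) ?uk ?leq_maxl // Euv.
rewrite dtrans_trans ?vk ?leq_maxl //.
by rewrite -(@dtrans_trans _ _ l) ?vl ?leq_maxr // Evw dtrans_trans ?wl ?leq_maxr.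
Qed.

Canonical deqv_equiv := EquivRel deqv deqv_refl deqv_sym deqv_trans.

Definition dlim := {eq_quot deqv}%qT.
HB.instance Definition _ := EqQuotient.on dlim.
HB.instance Definition _ := Choice.on dlim.

Definition dlim_in n (x : A n) : dlim := (\pi_dlim (Tagged A x))%qT.

Lemma dlim_inP m n (x : A m) (y : A n) :
  dlim_in x = dlim_in y <->
  exists k, [/\ m <= k, n <= k & dtrans x k = dtrans y k]%N.
Proof.
split=> [/eqmodP/asboolP // | xy].
by apply/eqmodP/asboolP.
Qed.

Lemma dlim_in_trans m k (x : A m) : (m <= k)%N -> dlim_in (dtrans x k) = dlim_in x.
Proof. by move=> lemk; apply/dlim_inP; exists k; rewrite dtrans_id. Qed.

Lemma dlim_inS n (x : A n) : dlim_in (f n x) = dlim_in x.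
Proof. by rewrite -(@dlim_in_trans n n.+1) // dtransS // dtrans_id. Qed.

Lemma dlim_in_repr (u : dlim) : u = dlim_in (tagged (repr u)).
Proof. by rewrite -[LHS]reprK /dlim_in; case: (repr u). Qed.

Lemma dlim_in1 (u : dlim) : exists n, exists x : A n, u = dlim_in x.
Proof. by exists (tag (repr u)), (tagged (repr u)); exact: dlim_in_repr. Qed.

Lemma dlim_in2 (u v : dlim) :
  exists n, exists x y : A n, u = dlim_in x /\ v = dlim_in y.
Proof.
have [m [x ->]] := dlim_in1 u; have [n [y ->]] := dlim_in1 v.
exists (maxn m n), (dtrans x _), (dtrans y _).
by rewrite !dlim_in_trans ?leq_maxl ?leq_maxr.
Qed.

Lemma dlim_in3 (u v w : dlim) : exists n, exists x y z : A n,
  [/\ u = dlim_in x, v = dlim_in y & w = dlim_in z].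
Proof.
have [m [x [y [-> ->]]]] := dlim_in2 u v; have [n [z ->]] := dlim_in1 w.
exists (maxn m n), (dtrans x _), (dtrans y _), (dtrans z _).
by rewrite !dlim_in_trans ?leq_maxl ?leq_maxr.
Qed.

Definition dlim_op2 (o : forall k, A k -> A k -> A k) (u v : dlim) : dlim :=
  let: k := maxn (tag (repr u)) (tag (repr v)) in
  dlim_in (o k (dtrans (tagged (repr u)) k) (dtrans (tagged (repr v)) k)).

Lemma dlim_op2E (o : forall k, A k -> A k -> A k) :
  (forall k x y, f k (o k x y) = o k.+1 (f k x) (f k y)) ->
  forall n (x y : A n), dlim_op2 o (dlim_in x) (dlim_in y) = dlim_in (o n x y).
Proof.
move=> fo n x y; rewrite /dlim_op2.
have := dlim_in_repr (dlim_in x); have := dlim_in_repr (dlim_in y).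
case: (repr (dlim_in x)) (repr (dlim_in y)) => [m x'] [l y'] /=.
move=> /dlim_inP[k [nk lk Ey]] /dlim_inP[k' [nk' mk' Ex]].
have tr_ge p (z : A p) q r : (p <= q)%N -> (q <= r)%N ->
  dtrans z r = dtrans (dtrans z q) r by move=> pq qr; rewrite dtrans_trans ?pq.
apply/dlim_inP; exists (maxn k k').
have mK: (m <= maxn k k')%N by rewrite leq_max mk' orbT.
have lK: (l <= maxn k k')%N by rewrite leq_max lk.
have nK: (n <= maxn k k')%N by rewrite leq_max nk.
rewrite geq_max mK lK nK; split=> //.
rewrite !(dtrans_op2 fo) ?geq_max ?mK //.
rewrite !dtrans_trans ?leq_maxl ?leq_maxr ?geq_max ?mK ?lK //; congr (o _ _ _).
  by rewrite (tr_ge _ x' k') ?leq_maxr // -Ex -tr_ge ?leq_maxr.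
by rewrite (tr_ge _ y' k) ?leq_maxl // -Ey -tr_ge ?leq_maxl.
Qed.

Definition dlim_op1 (o : forall k, A k -> A k) (u : dlim) : dlim :=
  dlim_in (o _ (tagged (repr u))).

Lemma dlim_op1E (o : forall k, A k -> A k) :
  (forall k x, f k (o k x) = o k.+1 (f k x)) ->
  forall n (x : A n), dlim_op1 o (dlim_in x) = dlim_in (o n x).
Proof.
move=> fo n x; rewrite /dlim_op1.
have := dlim_in_repr (dlim_in x); case: (repr (dlim_in x)) => [m x'] /=.
move=> /dlim_inP[k [nk mk Ex]]; apply/dlim_inP; exists k.
by rewrite !(dtrans_op1 fo) // Ex.
Qed.

Definition dlim_zero : dlim := @dlim_in 0 0.
Definition dlim_one : dlim := @dlim_in 0 1.
Definition dlim_opp := dlim_op1 (fun _ => -%R).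
Definition dlim_add := dlim_op2 (fun _ => +%R).
Definition dlim_mul := dlim_op2 (fun _ => *%R).
Definition dlim_scale (c : F) := dlim_op1 (fun _ => *:%R c).

Lemma dlim_zeroE n : dlim_zero = @dlim_in n 0.
Proof.
rewrite /dlim_zero -(@dlim_in_trans 0 n) //.
by rewrite (dtrans_op0 (o := fun k => 0)) // => k; exact: raddf0.
Qed.

Lemma dlim_oneE n : dlim_one = @dlim_in n 1.
Proof.
rewrite /dlim_one -(@dlim_in_trans 0 n) //.
by rewrite (dtrans_op0 (o := fun k => 1)) // => k; exact: rmorph1.
Qed.

Lemma dlim_oppE n (x : A n) : dlim_opp (dlim_in x) = dlim_in (- x).
Proof. by apply: (dlim_op1E (o := fun _ => -%R)) => k y; exact: raddfN. Qed.

Lemma dlim_scaleE c n (x : A n) : dlim_scale c (dlim_in x) = dlim_in (c *: x).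
Proof. by apply: (dlim_op1E (o := fun _ => *:%R c)) => k y; exact: linearZ. Qed.

Lemma dlim_addE n (x y : A n) :
  dlim_add (dlim_in x) (dlim_in y) = dlim_in (x + y).
Proof. by apply: (dlim_op2E (o := fun _ => +%R)) => k *; exact: raddfD. Qed.

Lemma dlim_mulE n (x y : A n) :
  dlim_mul (dlim_in x) (dlim_in y) = dlim_in (x * y).
Proof. by apply: (dlim_op2E (o := fun _ => *%R)) => k *; exact: rmorphM. Qed.

Lemma dlim_addA : associative dlim_add.
Proof.
move=> u v w; have [n [x [y [z [-> -> ->]]]]] := dlim_in3 u v w.
by rewrite !dlim_addE addrA.
Qed.

Lemma dlim_addC : commutative dlim_add.
Proof.
move=> u v; have [n [x [y [-> ->]]]] := dlim_in2 u v.
by rewrite !dlim_addE addrC.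
Qed.

Lemma dlim_add0 : left_id dlim_zero dlim_add.
Proof.
by move=> u; have [n [x ->]] := dlim_in1 u; rewrite (dlim_zeroE n) dlim_addE add0r.
Qed.

Lemma dlim_addN : left_inverse dlim_zero dlim_opp dlim_add.
Proof.
move=> u; have [n [x ->]] := dlim_in1 u.
by rewrite dlim_oppE dlim_addE addNr -dlim_zeroE.
Qed.

HB.instance Definition _ :=
  GRing.isZmodule.Build dlim dlim_addA dlim_addC dlim_add0 dlim_addN.

Lemma dlim_mulA : associative dlim_mul.
Proof.
move=> u v w; have [n [x [y [z [-> -> ->]]]]] := dlim_in3 u v w.
by rewrite !dlim_mulE mulrA.
Qed.

Lemma dlim_mul1 : left_id dlim_one dlim_mul.
Proof.
by move=> u; have [n [x ->]] := dlim_in1 u; rewrite (dlim_oneE n) dlim_mulE mul1r.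
Qed.

Lemma dlim_mulr1 : right_id dlim_one dlim_mul.
Proof.
by move=> u; have [n [x ->]] := dlim_in1 u; rewrite (dlim_oneE n) dlim_mulE mulr1.
Qed.

Lemma dlim_mulDl : left_distributive dlim_mul dlim_add.
Proof.
move=> u v w; have [n [x [y [z [-> -> ->]]]]] := dlim_in3 u v w.
by rewrite !(dlim_mulE, dlim_addE) mulrDl.
Qed.

Lemma dlim_mulDr : right_distributive dlim_mul dlim_add.
Proof.
move=> u v w; have [n [x [y [z [-> -> ->]]]]] := dlim_in3 u v w.
by rewrite !(dlim_mulE, dlim_addE) mulrDr.
Qed.

Lemma dlim_oner_neq0 : dlim_one != dlim_zero.
Proof.
apply/eqP => /dlim_inP[k [_ _]].
rewrite (dtrans_op0 (o := fun k => 1)) //; last by move=> n; exact: rmorph1.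
rewrite (dtrans_op0 (o := fun k => 0)) //; last by move=> n; exact: raddf0.
by apply/eqP; rewrite oner_eq0.
Qed.

HB.instance Definition _ := GRing.Zmodule_isNzRing.Build dlim
  dlim_mulA dlim_mul1 dlim_mulr1 dlim_mulDl dlim_mulDr dlim_oner_neq0.

Lemma dlim_scaleA c d u : dlim_scale c (dlim_scale d u) = dlim_scale (c * d) u.
Proof. by have [n [x ->]] := dlim_in1 u; rewrite !dlim_scaleE scalerA. Qed.

Lemma dlim_scale1 : left_id 1 dlim_scale.
Proof. by move=> u; have [n [x ->]] := dlim_in1 u; rewrite dlim_scaleE scale1r. Qed.

Lemma dlim_scaleDr : right_distributive dlim_scale +%R.
Proof.
move=> c u v; have [n [x [y [-> ->]]]] := dlim_in2 u v.
by rewrite [_ + _]dlim_addE !dlim_scaleE scalerDr -dlim_addE.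
Qed.

Lemma dlim_scaleDl u : {morph dlim_scale^~ u : c d / c + d}.
Proof.
move=> c d; have [n [x ->]] := dlim_in1 u.
by rewrite !dlim_scaleE scalerDl -dlim_addE.
Qed.

HB.instance Definition _ := GRing.Zmodule_isLmodule.Build F dlim
  dlim_scaleA dlim_scale1 dlim_scaleDr dlim_scaleDl.

Lemma dlim_scaleAl (c : F) (u v : dlim) : c *: (u * v) = (c *: u) * v.
Proof.
have [n [x [y [-> ->]]]] := dlim_in2 u v.
rewrite [_ * _]dlim_mulE [LHS]dlim_scaleE [in RHS]/(_ *: _) /= dlim_scaleE.
by rewrite [RHS]dlim_mulE scalerAl.
Qed.

HB.instance Definition _ := GRing.Lmodule_isLalgebra.Build F dlim dlim_scaleAl.

Lemma dlim_scaleAr (c : F) (u v : dlim) : c *: (u * v) = u * (c *: v).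
Proof.
have [n [x [y [-> ->]]]] := dlim_in2 u v.
rewrite [_ * _]dlim_mulE [LHS]dlim_scaleE [in RHS]/(_ *: _) /= dlim_scaleE.
by rewrite [RHS]dlim_mulE scalerAr.
Qed.

HB.instance Definition _ := GRing.Lalgebra_isAlgebra.Build F dlim dlim_scaleAr.

Lemma dlim_in_is_zmod_morphism n : zmod_morphism (@dlim_in n).
Proof.
by move=> x y; rewrite -dlim_addE -dlim_oppE.
Qed.

HB.instance Definition _ n :=
  GRing.isZmodMorphism.Build (A n) dlim (@dlim_in n)
    (@dlim_in_is_zmod_morphism n).

Lemma dlim_in_is_monoid_morphism n : monoid_morphism (@dlim_in n).
Proof. by split=> [|x y]; [rewrite -dlim_oneE | rewrite -dlim_mulE]. Qed.

HB.instance Definition _ n :=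
  GRing.isMonoidMorphism.Build (A n) dlim (@dlim_in n)
    (@dlim_in_is_monoid_morphism n).

Lemma dlim_in_is_scalable n : scalable (@dlim_in n).
Proof. by move=> c x; rewrite -dlim_scaleE. Qed.

HB.instance Definition _ n :=
  GRing.isScalable.Build F (A n) dlim *:%R (@dlim_in n) (@dlim_in_is_scalable n).

End DirectLimit.

Section GradedLimit.

Variables (F : fieldType) (gT : finGroupType) (A : nat -> gradedAlg F gT).
Variable f : forall n, gradedHom (A n) (A n.+1).

Local Notation L := (dlim (fun n => f n : {lrmorphism A n -> A n.+1})).
Local Notation inL := (@dlim_in F A (fun n => f n)).

Definition glim_comp (g : gT) : set L :=
  [set u | exists n (x : A n), gcomp g x /\ u = inL x]%classic.

Lemma dtrans_comp g m (x : A m) k : (m <= k)%N -> gcomp g x ->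
  gcomp g (dtrans (fun n => f n) x k).
Proof.
move=> lemk gx; elim: k lemk => [|k IHk].
  by rewrite leqn0 => /eqP m0; subst m; rewrite dtrans_id.
rewrite leq_eqVlt => /predU1P[Dk|lemk]; first by subst m; rewrite dtrans_id.
by rewrite dtransS //; apply: ghomP; apply: IHk.
Qed.

Lemma glim_comp_ge g u : glim_comp g u -> exists N, forall n, (N <= n)%N ->
  exists2 x : A n, gcomp g x & u = inL x.
Proof.
case=> [N [x [gx ->]]]; exists N => n leNn.
exists (dtrans (fun n => f n) x n); first exact: dtrans_comp.
by rewrite dlim_in_trans.
Qed.

Lemma glim_comp2 g h u v : glim_comp g u -> glim_comp h v ->
  exists n (x y : A n), [/\ gcomp g x, gcomp h y, u = inL x & v = inL y].
Proof.
move=> /glim_comp_ge[N uN] /glim_comp_ge[M vM].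
have [x gx Du] := uN (maxn N M) (leq_maxl _ _).
have [y hy Dv] := vM (maxn N M) (leq_maxr _ _).
by exists (maxn N M), x, y.
Qed.

Lemma glim_grading : is_grading glim_comp.
Proof.
split.
- move=> g; exists 0%N, 0; split; first exact: grading0 (gcompP (A 0)) g.
  by rewrite raddf0.
- move=> g c u v gu gv; have [n [x [y [gx gy -> ->]]]] := glim_comp2 gu gv.
  exists n, (c *: x + y); split; first exact: gradingP (gcompP (A n)) _ _ _ _ gx gy.
  by rewrite linearP.
- move=> g h u v gu hv; have [n [x [y [gx hy -> ->]]]] := glim_comp2 gu hv.
  exists n, (x * y); split; first exact: gradingM (gcompP (A n)) _ _ _ _ gx hy.
  by rewrite rmorphM.
- move=> u; have [n [x ->]] := dlim_in1 u.
  have [p gp ->] := grading_sum (gcompP (A n)) x.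
  by exists (fun g => inL (p g)) => [g|]; [exists n, (p g) | rewrite raddf_sum].
move=> p gp sum0.
have /choice[N pN] : forall g, exists N, forall n, (N <= n)%N ->
  exists2 x : A n, gcomp g x & p g = inL x by move=> g; exact: glim_comp_ge.
pose M := \max_g N g.
have /choice[x xP] : forall g, exists x : A M, gcomp g x /\ p g = inL x.
  by move=> g; have [|x] := pN g M; [exact: leq_bigmax | exists x].
have: inL (\sum_g x g) = inL (0 : A M).
  rewrite raddf_sum raddf0 -[RHS]sum0.
  by apply: eq_bigr => g _; have [] := xP g.
case/dlim_inP=> k [leMk _].
have tr0 : dtrans (fun n => f n) (0 : A M) k = 0.
  by rewrite (dtrans_op0 (o := fun=> 0)) // => i; exact: raddf0.
have trD (y z : A M) : dtrans (fun n => f n) (y + z) k =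
    dtrans (fun n => f n) y k + dtrans (fun n => f n) z k.
  by apply: (dtrans_op2 (o := fun=> +%R)) => // *; exact: raddfD.
rewrite tr0 (big_morph _ trD tr0) => tr_sum0 g.
have [_ ->] := xP g; rewrite -(dlim_in_trans _ _ leMk).
rewrite (grading_free (gcompP (A k)) _ tr_sum0) ?raddf0 // => h.
by apply: dtrans_comp => //; have [] := xP h.
Qed.

Definition glim : gradedAlg F gT := GradedAlg glim_grading.

End GradedLimit.

(* A nonempty tuple of degrees (g_1, ..., g_n), with n = dpred.+1: 'M_n is an
   algType only when n is a successor. *)
Record degtuple (gT : finGroupType) :=
  DegTuple { dpred : nat; deg :> 'I_dpred.+1 -> gT }.

Definition degmult (gT : finGroupType) (s : degtuple gT) : grpalg nat gT :=
  [ffun g => #|[set i | s i == g]|].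

Definition degs_seq (gT : finGroupType) (x : grpalg nat gT) : seq gT :=
  flatten [seq nseq (x g) g | g <- enum gT].

(* In this tuple each g occurs x g times (degs_ofK); for x = 0, which is
   excluded, it is the junk value (1). *)
Definition degs_of (gT : finGroupType) (x : grpalg nat gT) : degtuple gT :=
  @DegTuple gT (size (degs_seq x)).-1 (fun i => nth 1%g (degs_seq x) i).

Lemma degs_ofK (gT : finGroupType) (x : grpalg nat gT) :
  x != 0 -> degmult (degs_of x) = x.
Proof.
move=> x0; apply/ffunP=> g; rewrite ffunE.
have cntE h : count_mem h (degs_seq x) = x h.
  rewrite /degs_seq count_flatten -map_comp sumnE big_map big_enum /=.
  rewrite (bigD1 h) //= big1 ?addn0 => [|k /negPf kh];
    by rewrite count_nseq /= ?eqxx ?kh ?mul1n.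
have size_gt0 : (0 < size (degs_seq x))%N.
  rewrite lt0n; apply: contraNneq x0 => /size0nil xs0.
  by apply/eqP/ffunP=> h; rewrite ffunE -cntE xs0.
rewrite -[RHS]cntE -sum1_count (big_nth 1%g) big_mkord -sum1dep_card /=.
by rewrite -[in RHS](prednK size_gt0).
Qed.

(* If E_ii' and E_kk' have degrees g_i g_i'^-1 and h_k h_k'^-1, their Kronecker
   product is a matrix unit, graded by the tuple (g_i h_k)_(i, k). *)
Definition degs_tens (gT : finGroupType) (s t : degtuple gT) : degtuple gT :=
  @DegTuple gT ((dpred s).+1 * (dpred t).+1).-1
    (fun i : 'I_((dpred s).+1 * (dpred t).+1) =>
       (s (mxtens_unindex i).1 * t (mxtens_unindex i).2)%g).

Lemma degmult_tens (gT : finGroupType) (s t : degtuple gT) :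
  degmult (degs_tens s t) = degmult s * degmult t.
Proof.
have tensE (p : 'I_(dpred s).+1 * 'I_(dpred t).+1) :
    degs_tens s t (mxtens_index p) = (s p.1 * t p.2)%g.
  by rewrite -[in RHS](mxtens_indexK p).
apply/ffunP=> g; rewrite grpalg_mulE ffunE -sum1dep_card.
rewrite (reindex (@mxtens_index (dpred s).+1 (dpred t).+1)); last first.
  by exists (@mxtens_unindex _ _) => i _; rewrite (mxtens_indexK, mxtens_unindexK).
under eq_bigl do rewrite tensE.
rewrite -(pair_big_dep xpredT
  (fun i k => (s i * t k)%g == g) (fun _ _ => 1%N)) /=.
rewrite (partition_big s xpredT) //=; apply: eq_bigr => h _.
rewrite !ffunE -!sum1dep_card big_distrl /=; apply: eq_bigr => i /eqP->.
by rewrite mul1r; apply: eq_bigl => k; rewrite (can2_eq (mulKg h) (mulKVg h)).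
Qed.

Section MatrixGrading.

Variables (F : fieldType) (gT : finGroupType).

Local Notation M s := 'M[F]_((dpred s).+1).

(* The span of the matrix units E_ij with g_i g_j^-1 = g. *)
Definition mxcomp (s : degtuple gT) (g : gT) : set (M s) :=
  [set X | forall i j, X i j != 0 -> (s i * (s j)^-1)%g = g]%classic.

Lemma mxcomp_grading s : is_grading (@mxcomp s).
Proof.
split.
- by move=> g i j; rewrite mxE eqxx.
- move=> g c X Y gX gY i j; rewrite !mxE => XY.
  have [Xij0|] := eqVneq (X i j) 0; last exact: gX.
  by apply: gY; apply: contraNneq XY => ->; rewrite Xij0 mulr0 addr0.
- move=> g h X Y gX hY i j; rewrite mxE => XY.
  have [k] : exists k, X i k * Y k j != 0.
    apply/existsP; apply: contraNT XY => /existsPn XY0.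
    by rewrite big1 // => k _; apply/eqP; rewrite -[_ == _]negbK XY0.
  rewrite mulf_eq0 negb_or => /andP[/gX <- /hY <-].
  by rewrite mulgA mulgKV.
- move=> X; exists (fun g => \matrix_(i, j)
      if (s i * (s j)^-1)%g == g then X i j else 0) => [g i j|].
    by rewrite mxE; case: ifP => [/eqP -> //|_]; rewrite eqxx.
  apply/matrixP=> i j; rewrite summxE (bigD1 (s i * (s j)^-1)%g) //=.
  rewrite mxE eqxx big1 ?addr0 // => g /negPf.
  by rewrite mxE eq_sym => ->.
move=> p gp sum0 g; apply/matrixP=> i j; rewrite mxE.
have [//|pij] := eqVneq (p g i j) 0.
move/matrixP/(_ i j): sum0; rewrite summxE (bigD1 g) //= mxE.
rewrite big1 ?addr0 // => h hg; apply: contraNeq hg => /gp <-.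
by apply/eqP/gp.
Qed.

Definition Mdeg (s : degtuple gT) : gradedAlg F gT :=
  GradedAlg (mxcomp_grading s).

Definition tens1 (s t : degtuple gT) (X : M s) : M (degs_tens s t) :=
  X *t (1%:M : M t).

Lemma tens1_is_zmod_morphism s t : zmod_morphism (@tens1 s t).
Proof. by move=> X Y; apply/matrixP=> i j; rewrite !mxE mulrBl. Qed.

Lemma tens1_is_monoid_morphism s t : monoid_morphism (@tens1 s t).
Proof.
split=> [|X Y]; last first.
  by have /esym := tensmx_mul X (1%:M : M t) Y 1%:M; rewrite mulmx1.
apply/matrixP=> i j; rewrite !mxE -natrM mulnb -xpair_eqE -!surjective_pairing.
by rewrite (can_eq (@mxtens_unindexK _ _)).
Qed.

Lemma tens1_is_scalable s t : scalable (@tens1 s t).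
Proof. by move=> c X; apply/matrixP=> i j; rewrite !mxE mulrA. Qed.

HB.instance Definition _ s t := GRing.isZmodMorphism.Build
  (M s) (M (degs_tens s t)) (@tens1 s t) (@tens1_is_zmod_morphism s t).
HB.instance Definition _ s t := GRing.isMonoidMorphism.Build
  (M s) (M (degs_tens s t)) (@tens1 s t) (@tens1_is_monoid_morphism s t).
HB.instance Definition _ s t := GRing.isScalable.Build F
  (M s) (M (degs_tens s t)) *:%R (@tens1 s t) (@tens1_is_scalable s t).

Lemma tens1_graded s t g (X : Mdeg s) :
  gcomp g X -> gcomp (g : gT) (tens1 t X : Mdeg (degs_tens s t)).
Proof.
move=> gX i j; pose i' : 'I_((dpred s).+1 * (dpred t).+1) := i.
pose j' : 'I_((dpred s).+1 * (dpred t).+1) := j.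
rewrite mxE mulf_eq0 negb_or mxE => /andP[/gX <-].
case: ((mxtens_unindex i').2 =P (mxtens_unindex j').2) => [ij2 _|_];
  last by rewrite eqxx.
suff: (s (mxtens_unindex i').1 * t (mxtens_unindex i').2 *
       (s (mxtens_unindex j').1 * t (mxtens_unindex j').2)^-1 =
       s (mxtens_unindex i').1 * (s (mxtens_unindex j').1)^-1)%g by [].
by rewrite ij2 invMg mulgA mulgK.
Qed.

Definition tens1_hom s t : gradedHom (Mdeg s) (Mdeg (degs_tens s t)) :=
  GradedHom (@tens1_graded s t).

(* A tuple of degrees for M_(x_n), with x_n = x_0 a_1 ... a_n (chain_degsE) and
   a_1, a_2, ... indexed from 0. *)
Fixpoint chain_degs (x0 : grpalg nat gT) (a : nat -> grpalg nat gT) n :=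
  if n is n'.+1 then degs_tens (chain_degs x0 a n') (degs_of (a n'))
  else degs_of x0.

Lemma chain_degsE x0 a n : x0 != 0 -> (forall i, a i != 0) ->
  degmult (chain_degs x0 a n) = x0 * \prod_(i < n) a i.
Proof.
move=> x0_neq0 a_neq0; elim: n => [|n IHn] /=.
  by rewrite big_ord0 mulr1 degs_ofK.
by rewrite big_ord_recr mulrA -IHn degmult_tens degs_ofK.
Qed.

(* The infinite product of M_(x_0), M_(a_1), M_(a_2), ...: the direct limit of
   the maps X |-> X *t 1 on the M_(x_n). *)
Definition Minf (x0 : grpalg nat gT) (a : nat -> grpalg nat gT) :
  gradedAlg F gT := @glim F gT (fun n => Mdeg (chain_degs x0 a n))
    (fun n => tens1_hom (chain_degs x0 a n) (degs_of (a n))).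

End MatrixGrading.

(* Main.v *)
Require Import Defs.
From HB Require Import structures.
From mathcomp Require Import all_boot all_order all_algebra all_fingroup.
From mathcomp Require Import all_field all_character mxtens ring.
From mathcomp Require Import boolp classical_sets.

Set Implicit Arguments.
Unset Strict Implicit.
Unset Printing Implicit Defensive.

Import GRing.Theory Num.Theory.
Local Open Scope ring_scope.

(** A graded unital homomorphism from M_s to M_t makes the graded vector space
F^t a graded M_s-module, so F^t is the tensor product of F^s with a graded
multiplicity space.  Hence the homomorphism has the form
X |-> \sum_k u_k X v_k for homogeneous matrices u_k, v_k with v_k u_l = delta_kl
([emb_of_units]), and it has an invariant, the graded dimension w in N[G] of the
multiplicity space ([emb_mult]).  The invariant is well defined
([emb_mult_uniq]), satisfies t = s w, is multiplicative under composition, and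
is complete in the following strong sense ([emb_lift]): if D : M_s -> M_t and
I : M_s -> M_r have multiplicities z and z w, then I = E D for some E of
multiplicity w.

Write x_i = x_0 a_1 ... a_i for the i-th stage of the first tower, A_i for
a_1 ... a_i, and y_k = y_0 B_k for the second tower.  The stages being finite
dimensional, an isomorphism of the limits restricts to homomorphisms between
stages, in both directions, and composing them gives back the connecting maps.
Let c be the multiplicity of one of them, from x_0 to some y_K, and d = B_K.
Then c x_0 = d y_0, and reading the other ones through multiplicities shows that
every d A_i divides some c B_k in N[G], and every c B_k divides some d A_i
([cofinal_of_iso]).  Conversely, Q[G] is a product of fields indexed by the
Galois orbits of characters and all the factors in play have support S, so such
divisibilities can be cancelled to yield a ladder of multiplicities
between the two towers, which [emb_lift] turns step by step into a commuting
ladder of homomorphisms, that is, into an isomorphism of the limits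
([iso_of_cofinal]).

Finally K^+ is made of the fractions z / bar A_i, so b K^+ is contained in
b' K'^+ exactly when every (bar b') A_i divides some (bar b) B_k ([Kplus_leP]): the
two inclusions are the two divisibility conditions, for c = bar b and
d = bar b'. *)

(** * Elements of the rational group algebra as functions on the dual group *)

Section CharacterEvaluation.

Variable gT : finGroupType.
Implicit Types (chi psi : gdual gT) (z w : grpalg rat gT) (x y : grpalg nat gT).

(** The value at chi of the algebra morphism from Q[G] to Qbar that extends chi. *)
Definition evQ chi z : algC := \sum_g ratr (z g) * chi g.

Definition evn chi x : algC := evQ chi (ratG x).

Lemma evQM chi z w : evQ chi (z * w) = evQ chi z * evQ chi w.
Proof.
rewrite /evQ mulr_suml.
under eq_bigr do rewrite grpalg_mulE rmorph_sum mulr_suml.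
rewrite exchange_big /=; apply: eq_bigr => h _.
rewrite mulr_sumr (reindex_inj (mulgI h)) /=; apply: eq_bigr => g _.
by rewrite mulKg gdualM rmorphM /=; ring.
Qed.

Lemma evQ0 chi : evQ chi 0 = 0.
Proof. by rewrite /evQ big1 // => g _; rewrite ffunE rmorph0 mul0r. Qed.

Lemma evQ1 chi : evQ chi 1 = 1.
Proof.
rewrite /evQ (bigD1 1%g) //= big1 => [|g /negPf g1]; rewrite ffunE.
  by rewrite eqxx rmorph1 mul1r gdual1 addr0.
by rewrite g1 rmorph0 mul0r.
Qed.

Lemma evQD chi z w : evQ chi (z + w) = evQ chi z + evQ chi w.
Proof.
rewrite /evQ -big_split /=; apply: eq_bigr => g _.
by rewrite ffunE rmorphD mulrDl.
Qed.

Lemma evQB chi z w : evQ chi (z - w) = evQ chi z - evQ chi w.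
Proof.
rewrite /evQ -sumrB; apply: eq_bigr => g _.
by rewrite !ffunE rmorphB mulrBl.
Qed.

Lemma evQ_sum chi (I : finType) (P : pred I) (z : I -> grpalg rat gT) :
  evQ chi (\sum_(i | P i) z i) = \sum_(i | P i) evQ chi (z i).
Proof. by apply: (big_morph (evQ chi)); [exact: evQD | exact: evQ0]. Qed.

Lemma ratGM x y : ratG (x * y) = ratG x * ratG y.
Proof.
apply/ffunP=> g; rewrite ffunE !grpalg_mulE natr_sum.
by apply: eq_bigr => h _; rewrite !ffunE natrM.
Qed.

Lemma ratG1 : ratG (1 : grpalg nat gT) = 1.
Proof. by apply/ffunP=> g; rewrite !ffunE; case: eqP. Qed.

Lemma ratG_inj : injective (@ratG gT).
Proof.
move=> x y /ffunP xy; apply/ffunP=> g; have := xy g.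
by rewrite !ffunE => /eqP; rewrite eqr_nat => /eqP.
Qed.

Lemma evnM chi x y : evn chi (x * y) = evn chi x * evn chi y.
Proof. by rewrite /evn ratGM evQM. Qed.

Lemma evn1 chi : evn chi 1 = 1.
Proof. by rewrite /evn ratG1 evQ1. Qed.

Lemma gdualV_conj chi g : chi g^-1%g = (chi g)^*.
Proof.
have n_gt0 : (0 < #|gT|)%N by apply/card_gt0P; exists 1%g.
have norm1 : `|chi g| = 1.
  by apply/eqP; rewrite -(pexpr_eq1 n_gt0) // -normrX gdual_unity normr1.
by rewrite gdualV invC_norm norm1 expr1n invr1 mul1r.
Qed.

Lemma evn_bar chi x : evn chi (bar x) = (evn chi x)^*.
Proof.
rewrite /evn /evQ rmorph_sum (reindex_inj invg_inj) /=; apply: eq_bigr => g _.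
by rewrite !ffunE invgK rmorphM /= !ratr_nat rmorph_nat gdualV_conj.
Qed.

Lemma evn_bar_eq0 chi x : (evn chi (bar x) == 0) = (evn chi x == 0).
Proof. by rewrite evn_bar conjC_eq0. Qed.

Lemma barK : involutive (@bar nat gT).
Proof. by move=> x; apply/ffunP=> g; rewrite !ffunE invgK. Qed.

(** For chi != psi, a translation by an h with chi h != psi h multiplies the sum by
chi h / psi h, so the sum vanishes. *)
Lemma gdual_orth chi psi :
  \sum_g chi g * (psi g)^-1 = #|gT|%:R *+ (chi == psi).
Proof.
have [->|chi_psi] := eqVneq chi psi.
  rewrite -sum1_card natr_sum; apply: eq_bigr => g _.
  by rewrite -gdualV -gdualM mulgV gdual1.
have [h hP] : exists h, chi h * (psi h)^-1 != 1.
  apply/existsP; apply: contraNT chi_psi => /existsPn eq1.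
  apply/eqP/val_inj/ffunP=> g; have /eqP := negbNE (eq1 g).
  have psi0 : psi g != 0.
    apply/eqP => p0; have := gdualM psi g g^-1%g.
    by rewrite p0 mul0r mulgV gdual1 => /eqP; rewrite oner_eq0.
  by move/(congr1 ( *%R^~ (psi g))); rewrite mulfVK // mul1r.
rewrite mulr0n; apply/eqP; set s := \sum_g _.
have: chi h * (psi h)^-1 * s = s.
  rewrite [in RHS]/s (reindex_inj (mulgI h)) mulr_sumr; apply: eq_bigr => g _.
  by rewrite !gdualM invfM; ring.
move/eqP; rewrite -subr_eq0 -[X in _ - X]mul1r -mulrBl mulf_eq0 subr_eq0.
by rewrite (negPf hP).
Qed.

Lemma card_grp_neq0 : #|gT|%:R != 0 :> algC.
Proof. by rewrite pnatr_eq0 -lt0n; apply/card_gt0P; exists 1%g. Qed.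

Lemma char_idemE chi psi : \sum_g char_idem psi g * chi g = (chi == psi)%:R.
Proof.
apply: (mulfI card_grp_neq0); rewrite mulr_natr -gdual_orth mulr_sumr.
by apply: eq_bigr => g _; rewrite ffunE !mulrA mulfV ?card_grp_neq0 // mul1r mulrC.
Qed.

Lemma evQ_idem chi j : j \in gal_orbits gT ->
  evQ chi (orbit_idem j) = (chi \in j)%:R.
Proof.
move=> jP; rewrite /evQ; under eq_bigr do rewrite orbit_idemE // mulr_suml.
rewrite exchange_big /=; under eq_bigr do rewrite char_idemE.
have [chij|chij] := boolP (chi \in j).
  rewrite (bigD1 chi) //= eqxx big1 ?addr0 // => psi /andP[_].
  by rewrite eq_sym => /negPf->.
rewrite big1 // => psi psij; case: eqP => // Dpsi.
by rewrite Dpsi psij in chij.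
Qed.

Hypothesis abG : abelian [set: gT].

(** By the second orthogonality relation for the irreducible characters of G, which
are linear since G is abelian: the coefficients of z can be recovered from its
values at the characters.  Identities in Q[G] and N[G] are thereby reduced to
identities between algebraic numbers. *)
Lemma evQ_inj z w : (forall chi, evQ chi z = evQ chi w) -> z = w.
Proof.
move=> zw; apply/ffunP=> h; apply: (fmorph_inj (ratr : rat -> algC)).
have linG := char_abelianP _ abG.
pose dual i : {ffun gT -> algC} := [ffun g => 'chi[[set: gT]]_i g].
have dualP i : is_gchar (dual i).
  apply/andP; split; first by rewrite ffunE lin_char1.
  by apply/forallP=> g; apply/forallP=> k; rewrite !ffunE lin_charM ?inE.
have inv (y : grpalg rat gT) :
    #|gT|%:R * ratr (y h) = \sum_i evQ (GDual (dualP i)) y * ('chi_i h)^*.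
  rewrite /evQ; under eq_bigr do rewrite mulr_suml.
  rewrite exchange_big /= (bigD1 h) //= [X in _ + X]big1 => [|g gh].
    rewrite addr0; under eq_bigr do rewrite ffunE -mulrA.
    rewrite -mulr_sumr second_orthogonality_relation ?inE // class_refl mulr1n.
    rewrite mulrC (finset.setIidPl _) ?cardsT //; apply/fintype.subsetP=> k _.
    by apply/cent1P/(centsP abG); rewrite inE.
  under eq_bigr do rewrite ffunE -mulrA.
  rewrite -mulr_sumr second_orthogonality_relation ?inE //.
  case: imsetP => [[k _ Dk]|_]; last by rewrite mulr0n mulr0.
  by case/eqP: gh; rewrite Dk conjgE (centsP abG h _ k) ?inE // mulKg.
by apply: (mulfI card_grp_neq0); rewrite !inv; apply: eq_bigr => i _; rewrite zw.
Qed.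

Lemma evn_inj x y : (forall chi, evn chi x = evn chi y) -> x = y.
Proof. by move=> xy; apply/ratG_inj/evQ_inj. Qed.

Lemma grpalg_mulC x y : x * y = y * x.
Proof. by apply: evn_inj => chi; rewrite !evnM mulrC. Qed.

Lemma barM x y : bar (x * y) = bar x * bar y.
Proof. by apply: evn_inj => chi; rewrite !(evn_bar, evnM) rmorphM. Qed.

Lemma bar1 : bar (1 : grpalg nat gT) = 1.
Proof. by apply: evn_inj => chi; rewrite evn_bar evn1 rmorph1. Qed.

Lemma gal_orbitP chi psi :
  reflect (exists nu, psi = gdual_aut nu chi) (psi \in gal_orbit chi).
Proof.
rewrite inE; apply: (iffP (asboolP _)) => -[nu Dnu]; exists nu.
  by apply/val_inj/ffunP=> g; rewrite ffunE Dnu.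
by move=> g; rewrite Dnu ffunE.
Qed.

Lemma gal_orbit_refl chi : chi \in gal_orbit chi.
Proof.
apply/gal_orbitP; exists (idfun : {rmorphism algC -> algC}).
by apply/val_inj/ffunP=> g; rewrite ffunE.
Qed.

Lemma gal_orbits_mem chi : gal_orbit chi \in gal_orbits gT.
Proof. exact: imset_f. Qed.

(** Galois orbits partition the dual group, since every ring endomorphism of Qbar is
bijective. *)
Lemma gal_orbitE chi j : j \in gal_orbits gT ->
  (chi \in j) = (j == gal_orbit chi).
Proof.
case/imsetP=> chi0 _ ->; apply/idP/eqP => [|->]; last exact: gal_orbit_refl.
case/gal_orbitP=> nu Dchi.
have orb0 : chi0 \in gal_orbit chi.
  by rewrite -(gal_orbit_aut nu) -Dchi gal_orbit_refl.
apply/setP=> psi; apply/idP/idP => /gal_orbitP[mu ->].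
  by rewrite gal_orbit_aut.
by rewrite Dchi !gal_orbit_aut gal_orbit_refl.
Qed.

Lemma evQ_gdual_aut nu chi z : evQ (gdual_aut nu chi) z = nu (evQ chi z).
Proof.
rewrite /evQ rmorph_sum; apply: eq_bigr => g _.
by rewrite ffunE rmorphM /= fmorph_rat.
Qed.

(** The idempotent e_j is the indicator function of j on the dual group, and the
values of a rational element at the characters of one orbit are Galois
conjugates, so they vanish simultaneously. *)
Lemma mem_supp chi z : (gal_orbit chi \in supp z) = (evQ chi z != 0).
Proof.
rewrite inE gal_orbits_mem /=; congr (~~ _); apply/eqP/eqP => [ez0|z0].
  have := congr1 (evQ chi) ez0.
  by rewrite evQM evQ_idem ?gal_orbits_mem // gal_orbit_refl mul1r evQ0.
apply: evQ_inj => psi; rewrite evQM evQ_idem ?gal_orbits_mem // evQ0.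
have [|_] := boolP (psi \in _); last by rewrite mul0r.
by case/gal_orbitP=> nu ->; rewrite evQ_gdual_aut z0 rmorph0 mulr0.
Qed.

Lemma supp_orbits z : supp z \subset gal_orbits gT.
Proof. by apply/fintype.subsetP=> j; rewrite inE => /andP[]. Qed.

Lemma suppE (S : {set {set gdual gT}}) z : S \subset gal_orbits gT ->
  (forall chi, (gal_orbit chi \in S) = (evQ chi z != 0)) -> supp z = S.
Proof.
move=> /fintype.subsetP SP zS; apply/setP=> j.
have [/imsetP[chi _ ->]|jP] := boolP (j \in gal_orbits gT).
  by rewrite mem_supp zS.
rewrite inE (negPf jP) /=; apply/esym/negbTE; apply: contra jP; exact: SP.
Qed.

(** Multiplication by t is injective on Q[G], because evaluations are jointly
injective with values in a field; being linear on a finite-dimensional space, it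
is then bijective. *)
Lemma unit_of_evQ t : (forall chi, evQ chi t != 0) -> exists w, w * t = 1.
Proof.
move=> t0.
pose M := \matrix_(i < #|gT|, j < #|gT|) t ((enum_val i)^-1 * enum_val j)%g.
pose ofrow (v : 'rV_#|gT|) : grpalg rat gT := [ffun g => v 0 (enum_rank g)].
have ofrowM v : ofrow v * t = ofrow (v *m M).
  apply/ffunP=> g; rewrite grpalg_mulE ffunE mxE.
  rewrite (reindex _ (onW_bij _ (enum_val_bij gT))).
  by apply: eq_bigr => i _; rewrite !ffunE mxE enum_valK enum_rankK.
have ofrow_inj : injective ofrow.
  move=> u v /ffunP uv; apply/rowP=> i; have := uv (enum_val i).
  by rewrite !ffunE enum_valK.
have Mfree : row_free M.
  apply: inj_row_free => v vM0; apply: ofrow_inj; apply: evQ_inj => chi.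
  apply: (mulIf (t0 chi)); rewrite -!evQM ofrowM vM0; congr evQ.
  apply/ffunP=> g; rewrite grpalg_mulE !ffunE mxE big1 // => h _.
  by rewrite ffunE mxE mul0r.
pose r1 : 'rV[rat]_#|gT| := \row_i (1 : grpalg rat gT) (enum_val i).
exists (ofrow (r1 *m invmx M)).
rewrite ofrowM mulmxKV -?row_free_unit //.
by apply/ffunP=> g; rewrite ffunE mxE enum_rankK.
Qed.

Section Ideal.

Variable S : {set {set gdual gT}}.
Hypothesis SP : S \subset gal_orbits gT.

Lemma evQ_proj chi z :
  evQ chi (LS_proj S z) = (gal_orbit chi \in S)%:R * evQ chi z.
Proof.
rewrite /LS_proj evQ_sum.
under eq_bigr => j jS do rewrite evQM evQ_idem ?(fintype.subsetP SP) //.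
under eq_bigr => j jS do rewrite gal_orbitE ?(fintype.subsetP SP) //.
have [oS|oS] := boolP (_ \in S).
  rewrite (bigD1 (gal_orbit chi)) //= eqxx big1 ?addr0 // => j /andP[_ /negPf->].
  by rewrite mul0r.
rewrite mul0r big1 // => j jS; case: eqP => [jo|_]; last by rewrite mul0r.
by rewrite -jo jS in oS.
Qed.

Lemma evQ_one chi : evQ chi (LS_one S) = (gal_orbit chi \in S)%:R.
Proof.
have -> : LS_one S = LS_proj S 1 by apply: eq_bigr => j _; rewrite mulr1.
by rewrite evQ_proj evQ1 mulr1.
Qed.

Lemma LSP z : LS S z <-> forall chi, gal_orbit chi \notin S -> evQ chi z = 0.
Proof.
split=> [[w ->] chi oS | z0].
  rewrite evQ_sum big1 // => j jS; rewrite evQM evQ_idem ?(fintype.subsetP SP) //.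
  rewrite gal_orbitE ?(fintype.subsetP SP) //.
  case: eqP => [jo|_]; last by rewrite mul0r.
  by rewrite -jo jS in oS.
exists (fun=> z); apply: evQ_inj => chi.
rewrite -[X in _ = evQ _ X]/(LS_proj S z) evQ_proj.
by case: (boolP (_ \in S)) => [_|/z0->]; rewrite (mul1r, mulr0).
Qed.

Lemma LS_invertible z : (forall chi, gal_orbit chi \in S -> evQ chi z != 0) ->
  exists2 u, LS S u & forall chi, gal_orbit chi \in S -> evQ chi u * evQ chi z = 1.
Proof.
move=> z0; pose t := LS_proj S z + ((1 : grpalg rat gT) - LS_one S).
(* Off S, t is 1, which makes it invertible in the whole of Q[G]. *)
have [|w wP] := @unit_of_evQ t.
  move=> chi; rewrite /t evQD evQB evQ_proj evQ1 evQ_one.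
  have [oS|_] := boolP (_ \in S); first by rewrite mul1r subrr addr0 z0.
  by rewrite mul0r add0r subr0 oner_eq0.
exists (LS_proj S w) => [|chi oS].
  by apply/LSP=> chi /negPf oS; rewrite evQ_proj oS mul0r.
have /(congr1 (evQ chi)) := wP.
by rewrite evQM evQD evQB !evQ_proj evQ1 evQ_one oS subrr addr0 !mul1r.
Qed.

Lemma LS_inverseP z u : LS_inverse S (LS_proj S z) u <->
  LS S u /\ forall chi, gal_orbit chi \in S -> evQ chi u * evQ chi z = 1.
Proof.
split=> -[uS uz]; split=> //.
  move=> chi oS.
  by have /(congr1 (evQ chi)) := uz; rewrite evQM evQ_proj evQ_one oS mul1r.
apply: evQ_inj => chi; rewrite evQM evQ_proj evQ_one.
have [oS|oS] := boolP (_ \in S); first by rewrite mul1r uz.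
by rewrite mul0r mulr0.
Qed.

End Ideal.

End CharacterEvaluation.

(** * Inclusions of cones as divisibilities *)

Section Cone.

Variable gT : finGroupType.
Hypothesis abG : abelian [set: gT].
Implicit Types (chi : gdual gT) (x : grpalg nat gT) (a : nat -> grpalg nat gT).

Definition partprod a i := \prod_(l < i) a l.

Lemma partprodS a i : partprod a i.+1 = partprod a i * a i.
Proof. exact: big_ord_recr. Qed.

Lemma partprod_cat a m k : (m <= k)%N ->
  partprod a k = partprod a m * \prod_(m <= l < k) a l.
Proof. by move=> lemk; rewrite /partprod -!(big_mkord xpredT) -big_cat_nat. Qed.

Lemma partprod0 a : partprod a 0 = 1.
Proof. exact: big_ord0. Qed.

Lemma evn_partprod chi a i : evn chi (partprod a i) = \prod_(l < i) evn chi (a l).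
Proof. by apply: (big_morph (evn chi)); [exact: evnM | exact: evn1]. Qed.

Lemma bprodE a i : bprod a i = bar (partprod a i.+1).
Proof. by rewrite /partprod (big_morph _ (barM abG) (bar1 abG)). Qed.

Variable S : {set {set gdual gT}}.

Lemma mem_suppn x chi :
  supp (ratG x) = S -> (gal_orbit chi \in S) = (evn chi x != 0).
Proof. by move=> <-; rewrite mem_supp. Qed.

Lemma evn_neq0 x chi : supp (ratG x) = S -> gal_orbit chi \in S -> evn chi x != 0.
Proof. by move=> /mem_suppn->. Qed.

Lemma evn_eq0 x chi : supp (ratG x) = S -> gal_orbit chi \notin S -> evn chi x = 0.
Proof. by move=> /mem_suppn->; rewrite negbK => /eqP. Qed.

Lemma partprod_neq0 a i chi : (forall l, supp (ratG (a l)) = S) ->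
  gal_orbit chi \in S -> evn chi (partprod a i) != 0.
Proof.
by move=> aS oS; rewrite evn_partprod; apply/prodf_neq0 => l _; apply: evn_neq0.
Qed.

(** An element of L_S is determined by its values at the characters over S, and
these turn division by b_i into division in a field. *)
Lemma KplusP a y : (forall l, supp (ratG (a l)) = S) ->
  Kplus S a y <-> LS S y /\ exists i c, forall chi, gal_orbit chi \in S ->
    evQ chi y * evn chi (bar (partprod a i.+1)) = evn chi c.
Proof.
move=> aS; have SP : S \subset gal_orbits gT by rewrite -(aS 0%N) supp_orbits.
have b0 i chi : gal_orbit chi \in S -> evQ chi (ratG (bar (partprod a i.+1))) != 0.
  by move=> oS; rewrite -[evQ _ _]/(evn _ _) evn_bar_eq0 partprod_neq0.
split=> [[i [c [u []]]] | [yS [i [c yc]]]].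
  rewrite bprodE LS_inverseP // => -[uS ub] ->; split.
    by apply/LSP => // chi oS; rewrite evQM evQ_proj // (negPf oS) mul0r mulr0.
  exists i, c => chi oS; rewrite evQM evQ_proj // oS mul1r mulrAC.
  by rewrite /evn ub // mul1r.
have [u uS ub] := LS_invertible abG SP (b0 i).
exists i, c, u; rewrite bprodE LS_inverseP //; split=> //.
apply: evQ_inj => // chi; rewrite evQM evQ_proj //.
have [oS|oS] := boolP (_ \in S); last first.
  by rewrite mul0r mulr0; move/LSP: yS => ->.
rewrite mul1r -[evQ chi (ratG c)]/(evn chi c) -yc // mulrCA.
by rewrite [X in _ * X]ub // mulr1.
Qed.

(** The quotients c are to be multiplicities of graded homomorphisms, which is why
they are taken in N[G] and not in Q[G]. *)
Definition cofinal (b b' : grpalg nat gT) a a' :=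
  forall i, exists k c, b * partprod a' k = b' * partprod a i * c.

(** The cone of a is generated by the inverses of the bar A_i over N[G], and
b / bar A_i = b' z / bar A'_k means b bar A'_k = b' z bar A_i in L_S, and then in
N[G] since both sides vanish outside S. *)
Lemma Kplus_leP a a' b b' :
    (forall l, supp (ratG (a l)) = S) -> (forall l, supp (ratG (a' l)) = S) ->
    supp (ratG b) = S -> supp (ratG b') = S ->
  ([set ratG b * y | y in Kplus S a] `<=`
   [set ratG b' * y | y in Kplus S a'])%classic
  <-> cofinal (bar b) (bar b') a a'.
Proof.
move=> aS a'S bS b'S.
have SP : S \subset gal_orbits gT by rewrite -bS supp_orbits.
split=> [leK i | dom _ [y /(KplusP _ aS)[yS [i [c yc]]] <-]].
  have a0 chi : gal_orbit chi \in S -> evQ chi (ratG (bar (partprod a i.+1))) != 0.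
    by move=> oS; rewrite -[evQ _ _]/(evn _ _) evn_bar_eq0 partprod_neq0.
  have [y yS ya] := LS_invertible abG SP a0.
  have Ky : Kplus S a y.
    apply/KplusP => //; split=> //; exists i, 1 => chi oS.
    by rewrite evn1 -(ya chi).
  have [y' /(KplusP _ a'S)[_ [k [c y'c]]] y'y] := leK _ (ex_intro2 _ _ y Ky erefl).
  exists k.+1, (bar c * a i); rewrite -[LHS](@barK gT) -[RHS](@barK gT).
  congr bar; rewrite !(barM abG) !(@barK gT); apply: evn_inj => // chi.
  rewrite !evnM.
  have [oS|oS] := boolP (gal_orbit chi \in S); last first.
    by rewrite (evn_eq0 bS oS) (evn_eq0 b'S oS) !mul0r.
  have := ya chi oS; have := y'c chi oS; have := congr1 (evQ chi) y'y.
  rewrite !evQM -![evQ chi (ratG _)]/(evn _ _) [partprod a i.+1]partprodS.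
  rewrite (barM abG) evnM.
  move: (evn chi b) (evn chi b') (evQ chi y) (evQ chi y')
    (evn chi (bar (partprod a i))) (evn chi (bar (partprod a' k.+1)))
    (evn chi (bar (a i))) (evn chi c).
  move=> B B' Y Y' A A' E C BY Y'A' YAE.
  rewrite -[LHS]mulr1 -YAE -Y'A'.
  have -> : B * A' * (Y * (A * E)) = B * Y * A' * A * E by ring.
  by rewrite -BY; ring.
have [k [d dom_i]] := dom i.+1.
have b'0 chi : gal_orbit chi \in S -> evQ chi (ratG b') != 0.
  by move=> oS; apply: evn_neq0.
have [u uS ub'] := LS_invertible abG SP b'0.
exists (u * (ratG b * y)); last first.
  apply: evQ_inj => // chi; rewrite !evQM.
  have [oS|oS] := boolP (gal_orbit chi \in S); last first.
    rewrite -![evQ chi (ratG _)]/(evn _ _).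
    by rewrite (evn_eq0 bS oS) (evn_eq0 b'S oS) !mul0r.
  by rewrite mulrA [evQ chi (ratG b') * _]mulrC ub' // mul1r.
apply/KplusP => //; split.
  by apply/LSP => // chi oS; rewrite evQM; move/LSP: uS => -> //; rewrite mul0r.
exists k, (c * bar d * bar (a' k)) => chi oS.
have := congr1 (evn chi \o @bar nat gT) dom_i.
rewrite /= !(barM abG) !(@barK gT) !evnM.
have := ub' chi oS; have := yc chi oS; rewrite !evQM -![evQ chi (ratG _)]/(evn _ _).
rewrite [partprod a' k.+1]partprodS (barM abG) evnM.
move: (evn chi b) (evn chi b') (evQ chi u) (evQ chi y)
  (evn chi (bar (partprod a i.+1))) (evn chi (bar (partprod a' k)))
  (evn chi (bar d)) (evn chi c) (evn chi (bar (a' k))).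
move=> B B' U Y A A' D C E YA UB' BA.
have -> : U * (B * Y) * (A' * E) = U * Y * (B * A') * E by ring.
rewrite BA.
have -> : U * Y * (B' * A * D) * E = (U * B') * (Y * A) * D * E by ring.
by rewrite UB' YA mul1r.
Qed.

End Cone.

(** * Families of degrees and their generating elements *)

Section DegreeCount.

Variable gT : finGroupType.

(** The generating element of a family of degrees; [degmult s] is [dcount s]. *)
Definition dcount (I : finType) (c : I -> gT) : grpalg nat gT :=
  [ffun g => #|[set i | c i == g]|].

Lemma dcountM (I J : finType) (c : I -> gT) (d : J -> gT) :
  dcount (fun p : I * J => (c p.1 * d p.2)%g) = dcount c * dcount d.
Proof.
apply/ffunP=> g; rewrite grpalg_mulE ffunE -sum1dep_card.
rewrite -(pair_big_dep xpredT (fun i j => (c i * d j)%g == g) (fun _ _ => 1%N)) /=.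
rewrite (partition_big c xpredT) //=; apply: eq_bigr => h _.
rewrite !ffunE -!sum1dep_card big_distrl /=; apply: eq_bigr => i /eqP->.
by rewrite mul1r; apply: eq_bigl => k; rewrite (can2_eq (mulKg h) (mulKVg h)).
Qed.

Lemma dcount_realize (x : grpalg nat gT) :
  exists (I : finType) (c : I -> gT), dcount c = x.
Proof.
exists {g : gT & 'I_(x g)}, (fun p => tag p); apply/ffunP=> g; rewrite ffunE.
rewrite -sum1dep_card big_mkcond /=.
rewrite -(@sig_big_dep _ _ _ _ (fun h => 'I_(x h)) xpredT (fun _ => xpredT)
  (fun h _ => if h == g then 1%N else 0%N)) /=.
rewrite (bigD1 g) //= eqxx sum1_card card_ord big1 ?addn0 // => h /negPf->.
by rewrite big1.
Qed.

(** Both families have fibers of the same size over each degree; the i-th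
element of a fiber is matched with the i-th element of the other one. *)
Lemma dcount_bij (I J : finType) (c : I -> gT) (d : J -> gT) :
  dcount c = dcount d ->
  exists f : I -> J, exists f' : J -> I,
    [/\ cancel f f', cancel f' f & forall i, d (f i) = c i].
Proof.
move=> cd.
have cardE_ g : #|[set i | c i == g]| = #|[set j | d j == g]|.
  by move/ffunP/(_ g): cd; rewrite !ffunE.
have lt_rank (i : I) :
    (index i (enum [set k | c k == c i]) < #|[set j | d j == c i]|)%N.
  by rewrite -cardE_ cardE index_mem mem_enum inE.
pose f i := enum_val (Ordinal (lt_rank i)).
have fc i : d (f i) = c i.
  by have := enum_valP (Ordinal (lt_rank i)); rewrite inE => /eqP.
have f_inj : injective f.
  move=> i k fik; have cik : c i = c k by rewrite -!fc fik.
  have /eqP := fik; rewrite /f !(enum_val_nth (f i)) /= -cik.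
  rewrite nth_uniq ?enum_uniq -?cardE ?lt_rank //; last first.
    by have := lt_rank k; rewrite -cik.
  move=> /eqP/(congr1 (nth i (enum [set k | c k == c i]))).
  by rewrite !nth_index // mem_enum inE // cik.
have cardIJ : (#|J| <= #|I|)%N.
  rewrite -!sum1_card (partition_big c xpredT) // (partition_big d xpredT) //=.
  by apply: leq_sum => g _; rewrite !sum1dep_card cardE_.
by have [f' fK f'K] := inj_card_bij f_inj cardIJ; exists f, f'.
Qed.

End DegreeCount.

(** * Graded embeddings of matrix algebras and their multiplicities *)

Section Embeddings.

Variables (F : fieldType) (gT : finGroupType).

Local Notation M s := 'M[F]_((dpred s).+1).

Lemma sum_neq0 (I : finType) (f : I -> F) : \sum_i f i != 0 -> exists i, f i != 0.
Proof.
move=> f0; apply/existsP; apply: contraNT f0 => /existsPn f0.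
by rewrite big1 // => k _; apply/eqP; rewrite -[_ == _]negbK f0.
Qed.

Lemma mulmx_neq0 m n p (A : 'M[F]_(m, n)) (B : 'M_(n, p)) i j :
  (A *m B) i j != 0 -> exists2 k, A i k != 0 & B k j != 0.
Proof.
by rewrite mxE => /sum_neq0[k]; rewrite mulf_eq0 negb_or => /andP[]; exists k.
Qed.

(** A graded unital homomorphism from M_s to M_t together with a decomposition of
F^t into copies of F^s: the copy of index k is the image of [eout k], the
projection on it is [ein k], and its degrees are those of s shifted by
[edeg k]. *)
Record mxemb (s t : degtuple gT) := MxEmb {
  eidx : finType;
  edeg : eidx -> gT;
  eout : eidx -> 'M[F]_((dpred t).+1, (dpred s).+1);
  ein : eidx -> 'M[F]_((dpred s).+1, (dpred t).+1);
  einK : forall k l, ein k *m eout l = (k == l)%:R%:M;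
  eoutK : \sum_k eout k *m ein k = 1%:M;
  eout_deg : forall k i j, eout k i j != 0 -> t i = (s j * edeg k)%g;
  ein_deg : forall k i j, ein k j i != 0 -> t i = (s j * edeg k)%g
}.

Arguments edeg {s t} m k.
Arguments eout {s t} m k.
Arguments ein {s t} m k.

Definition emb_fun s t (E : mxemb s t) (X : M s) : M t :=
  \sum_k eout E k *m X *m ein E k.

Definition emb_mult s t (E : mxemb s t) : grpalg nat gT := dcount (edeg E).

Section Theory.

Variables (s t : degtuple gT) (E : mxemb s t).
Implicit Types X Y : M s.

Lemma emb_fun_is_linear : linear (emb_fun E).
Proof.
move=> c X Y; rewrite /emb_fun scaler_sumr -big_split /=; apply: eq_bigr => k _.
by rewrite mulmxDr mulmxDl -scalemxAr -scalemxAl.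
Qed.

HB.instance Definition _ :=
  GRing.isLinear.Build F (M s) (M t) *:%R (emb_fun E) emb_fun_is_linear.

Lemma ein_emb k X : ein E k *m emb_fun E X = X *m ein E k.
Proof.
rewrite mulmx_sumr (bigD1 k) //= big1 => [|l lk].
  by rewrite addr0 !mulmxA einK eqxx mul1mx.
by rewrite !mulmxA einK eq_sym (negPf lk) mul_scalar_mx scale0r !mul0mx.
Qed.

Lemma emb_eout k X : emb_fun E X *m eout E k = eout E k *m X.
Proof.
rewrite mulmx_suml (bigD1 k) //= big1 => [|l lk].
  by rewrite addr0 -!mulmxA einK eqxx mulmx1.
by rewrite -!mulmxA einK (negPf lk) mul_mx_scalar scale0r !mulmx0.
Qed.

Lemma emb_funE k X l : ein E k *m emb_fun E X *m eout E l = (k == l)%:R *: X.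
Proof.
by rewrite ein_emb -mulmxA einK mul_mx_scalar.
Qed.

Lemma emb_funM X Y : emb_fun E (X *m Y) = emb_fun E X *m emb_fun E Y.
Proof.
rewrite [RHS]mulmx_suml; apply: eq_bigr => k _.
by rewrite -[RHS]mulmxA ein_emb !mulmxA.
Qed.

Lemma emb_fun1 : emb_fun E 1%:M = 1%:M.
Proof. by rewrite -(eoutK E); apply: eq_bigr => k _; rewrite mulmx1. Qed.

Lemma emb_fun_inj : injective (emb_fun E).
Proof.
case: (pickP (@predT (eidx E))) => [k _|no_idx].
  move=> X Y EXY; have := emb_funE k X k.
  by rewrite EXY emb_funE eqxx !scale1r => <-.
have /eqP := eoutK E; rewrite big1 => [|k _]; last by have := no_idx k.
by rewrite eq_sym oner_eq0.
Qed.

Lemma emb_fun_graded (g : gT) X :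
  mxcomp (s := t) g (emb_fun E X) <-> mxcomp (s := s) g X.
Proof.
split=> gX i i'.
  have [k _|no_idx] := pickP (@predT (eidx E)); last first.
    have /eqP := eoutK E; rewrite big1 => [|k _]; last by have := no_idx k.
    by rewrite eq_sym oner_eq0.
  have := emb_funE k X k; rewrite eqxx scale1r => DX; rewrite -{1}DX.
  case/mulmx_neq0=> j' /mulmx_neq0[j /ein_deg tj /gX <-] /eout_deg->.
  by rewrite tj invMg -!mulgA mulKVg.
rewrite summxE => /sum_neq0[k].
case/mulmx_neq0=> j' /mulmx_neq0[j /eout_deg-> /gX <-] /ein_deg->.
by rewrite invMg -!mulgA mulKVg.
Qed.

End Theory.

Section Composition.

Variables (s t r : degtuple gT) (D : mxemb s t) (E : mxemb t r).

Let K := (eidx D * eidx E)%type.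

Lemma comp_einK (k l : K) :
  (ein D k.1 *m ein E k.2) *m (eout E l.2 *m eout D l.1) = (k == l)%:R%:M.
Proof.
case: k l => [k k'] [l l'] /=; rewrite -mulmxA [ein E k' *m _]mulmxA einK.
rewrite mul_scalar_mx -scalemxAr einK xpair_eqE andbC.
case: eqP => _; rewrite ?scale1r ?scale0r //.
by apply/matrixP=> i j; rewrite !mxE mul0rn.
Qed.

Lemma comp_fun_pair X :
  \sum_(k : K) (eout E k.2 *m eout D k.1) *m X *m (ein D k.1 *m ein E k.2)
  = emb_fun E (emb_fun D X).
Proof.
rewrite -(pair_bigA _ (fun k k' =>
  (eout E k' *m eout D k) *m X *m (ein D k *m ein E k'))).
rewrite exchange_big /=; apply: eq_bigr => k' _.
rewrite mulmx_sumr mulmx_suml; apply: eq_bigr => k _.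
by rewrite !mulmxA.
Qed.

Lemma comp_eoutK :
  \sum_(k : K) (eout E k.2 *m eout D k.1) *m (ein D k.1 *m ein E k.2) = 1%:M.
Proof.
rewrite -(emb_fun1 E) -(emb_fun1 D) -comp_fun_pair.
by apply: eq_bigr => k _; rewrite mulmx1.
Qed.

Lemma comp_eout_deg (k : K) i j :
  (eout E k.2 *m eout D k.1) i j != 0 -> r i = (s j * (edeg D k.1 * edeg E k.2))%g.
Proof. by case/mulmx_neq0=> l /eout_deg-> /eout_deg->; rewrite mulgA. Qed.

Lemma comp_ein_deg (k : K) i j :
  (ein D k.1 *m ein E k.2) j i != 0 -> r i = (s j * (edeg D k.1 * edeg E k.2))%g.
Proof. by case/mulmx_neq0=> l /ein_deg Dl /ein_deg->; rewrite Dl mulgA. Qed.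

Definition emb_comp : mxemb s r :=
  MxEmb comp_einK comp_eoutK comp_eout_deg comp_ein_deg.

Lemma emb_comp_fun X : emb_fun emb_comp X = emb_fun E (emb_fun D X).
Proof. exact: comp_fun_pair. Qed.

Lemma emb_comp_mult : emb_mult emb_comp = emb_mult D * emb_mult E.
Proof. exact: dcountM. Qed.

End Composition.

Section IdentityEmbedding.

Variable s : degtuple gT.

Lemma id_einK (k l : unit) : 1%:M *m 1%:M = (k == l)%:R%:M :> M s.
Proof. by case: k; case: l; rewrite mulmx1. Qed.

Lemma id_eoutK : \sum_(k : unit) (1%:M *m 1%:M : M s) = 1%:M.
Proof. by rewrite (big_pred1 tt) => [|[]]; rewrite ?mulmx1. Qed.

Lemma id_eout_deg (k : unit) i j : (1%:M : M s) i j != 0 -> s i = (s j * 1)%g.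
Proof. by rewrite mxE mulg1; case: (eqVneq i j) => [-> //|_]; rewrite eqxx. Qed.

Lemma id_ein_deg (k : unit) i j : (1%:M : M s) j i != 0 -> s i = (s j * 1)%g.
Proof. by rewrite mxE mulg1; case: (eqVneq j i) => [-> //|_]; rewrite eqxx. Qed.

Definition emb_id : mxemb s s := MxEmb id_einK id_eoutK id_eout_deg id_ein_deg.

Lemma emb_id_fun X : emb_fun emb_id X = X.
Proof. by rewrite /emb_fun (big_pred1 tt) => [|[]]; rewrite ?mulmx1 ?mul1mx. Qed.

Lemma emb_id_mult : emb_mult emb_id = 1.
Proof.
apply/ffunP=> g; rewrite !ffunE -sum1dep_card big_mkcond.
rewrite (big_pred1 tt) => [|[]] //=.
by rewrite eq_sym; case: eqP.
Qed.

End IdentityEmbedding.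

(** M_1 embeds in every M_s with multiplicity the multiset of degrees of s, which
turns statements on degree tuples into statements on multiplicities. *)
Definition deg1 : degtuple gT := @DegTuple gT 0 (fun=> 1%g).

Section UnitEmbedding.

Variable s : degtuple gT.

Let out (k : 'I_(dpred s).+1) : 'M[F]_((dpred s).+1, 1) := delta_mx k 0.
Let in_ (k : 'I_(dpred s).+1) : 'M[F]_(1, (dpred s).+1) := delta_mx 0 k.

Lemma unit_einK k l : in_ k *m out l = (k == l)%:R%:M.
Proof.
apply/matrixP=> i j; rewrite !ord1 !mxE eqxx mulr1n (bigD1 k) //= !mxE !eqxx mul1r.
by rewrite andbT big1 ?addr0 // => m /negPf mk; rewrite !mxE mk andbF mul0r.
Qed.

Lemma unit_eoutK : \sum_k out k *m in_ k = 1%:M.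
Proof.
rewrite [RHS]matrix_sum_delta; apply: eq_bigr => k _.
rewrite mul_delta_mx (bigD1 k) //= big1 => [|l /negPf lk].
  by rewrite addr0 mxE eqxx scale1r.
by rewrite mxE eq_sym lk scale0r.
Qed.

Lemma unit_eout_deg k i j : out k i j != 0 -> s i = (deg1 j * s k)%g.
Proof. by rewrite mxE mul1g; case: (eqVneq i k) => [-> //|_]; rewrite eqxx. Qed.

Lemma unit_ein_deg k i j : in_ k j i != 0 -> s i = (deg1 j * s k)%g.
Proof.
by rewrite mxE mul1g andbC; case: (eqVneq i k) => [-> //|_]; rewrite eqxx.
Qed.

Definition emb_unit : mxemb deg1 s :=
  @MxEmb deg1 s _ _ _ _ unit_einK unit_eoutK unit_eout_deg unit_ein_deg.

Lemma emb_unit_mult : emb_mult emb_unit = degmult s.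
Proof. by []. Qed.

End UnitEmbedding.

Section TensorEmbedding.

Variables s t : degtuple gT.

Let ix (i : 'I_(dpred (degs_tens s t)).+1) : 'I_(dpred s).+1 * 'I_(dpred t).+1 :=
  @mxtens_unindex (dpred s).+1 (dpred t).+1 i.

Let ixK : bijective ix.
Proof.
by exists (@mxtens_index (dpred s).+1 (dpred t).+1) => i;
  [exact: mxtens_unindexK | exact: mxtens_indexK].
Qed.

Let out (k : 'I_(dpred t).+1) : 'M[F]_((dpred (degs_tens s t)).+1, (dpred s).+1) :=
  \matrix_(i, j) (ix i == (j, k))%:R.

Let outE k i j : out k i j = (((ix i).1 == j) && ((ix i).2 == k))%:R.
Proof. by rewrite mxE -xpair_eqE -surjective_pairing. Qed.

Let out_eq0 k i j : out k i j != 0 -> ix i = (j, k).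
Proof. by rewrite mxE; case: (ix i =P (j, k)) => // _; rewrite eqxx. Qed.

Lemma tens_einK k l : (out k)^T *m out l = (k == l)%:R%:M.
Proof.
have [ixV ixK1 ixK2] := ixK.
apply/matrixP=> i j; rewrite !mxE (reindex ixV) /=; last by exists ix => x _.
rewrite (bigD1 (i, k)) //= big1 => [|p /negPf pik]; rewrite !mxE ixK2.
  by rewrite eqxx mul1r xpair_eqE addr0; case: (i == j); case: (k == l).
by rewrite pik mul0r.
Qed.

(** The Kronecker product by the identity repeats X along the indices with a given
second component k, for each k. *)
Lemma tens_fun X : \sum_k out k *m X *m (out k)^T = tens1 t X.
Proof.
apply/matrixP=> i i'; rewrite summxE.
have E k : (out k *m X *m (out k)^T) i i' =
    ((ix i).2 == k)%:R * X (ix i).1 (ix i').1 * ((ix i').2 == k)%:R.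
  rewrite mxE (bigD1 (ix i').1) //= big1 ?addr0 => [|j' /negPf j'i'].
    rewrite [_^T _ _]mxE outE eqxx; congr (_ * _).
    rewrite mxE (bigD1 (ix i).1) //= big1 ?addr0 => [|j /negPf ji].
      by rewrite outE eqxx.
    by rewrite outE eq_sym ji mul0r.
  by rewrite [_^T _ _]mxE outE eq_sym j'i' mulr0.
under eq_bigr do rewrite E.
rewrite !mxE (bigD1 (ix i).2) //= eqxx mul1r big1 ?addr0 => [|k /negPf ki].
  by rewrite eq_sym.
by rewrite eq_sym ki !mul0r.
Qed.

Lemma tens_eoutK : \sum_k out k *m (out k)^T = 1%:M.
Proof.
transitivity (tens1 t (1%:M : M s)).
  by rewrite -tens_fun; apply: eq_bigr => k _; rewrite mulmx1.
exact: (tens1_is_monoid_morphism F s t).1.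
Qed.

Lemma tens_eout_deg k i j : out k i j != 0 -> degs_tens s t i = (s j * t k)%g.
Proof.
have -> : degs_tens s t i = (s (ix i).1 * t (ix i).2)%g by [].
by move=> /out_eq0->.
Qed.

Lemma tens_ein_deg k i j : (out k)^T j i != 0 -> degs_tens s t i = (s j * t k)%g.
Proof. by rewrite mxE; exact: tens_eout_deg. Qed.

Definition emb_tens : mxemb s (degs_tens s t) :=
  MxEmb tens_einK tens_eoutK tens_eout_deg tens_ein_deg.

Lemma emb_tens_fun X : emb_fun emb_tens X = tens1 t X.
Proof. exact: tens_fun. Qed.

Lemma emb_tens_mult : emb_mult emb_tens = degmult t.
Proof. by []. Qed.

End TensorEmbedding.

(** The matrices w_kl = ein_D k eout_E l intertwine the two decompositions of F^t.
They commute with M_s, hence are scalar, and are homogeneous, hence vanish unless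
edeg k = edeg l.  So the scalars form mutually inverse rectangular matrices
between the indices of D and those of E, block by block for each degree. *)
Lemma emb_mult_le s t (D E : mxemb s t) (g : gT) :
  emb_fun D =1 emb_fun E -> (emb_mult D g <= emb_mult E g)%N.
Proof.
move=> DE; rewrite !ffunE.
pose a k l := (ein D k *m eout E l) 0 0; pose b l k := (ein E l *m eout D k) 0 0.
(* Only the first column of a scalar matrix is used, which requires commutation
   with a single matrix unit. *)
have b_col l k m : m != 0 -> (ein E l *m eout D k) m 0 = 0.
  move=> /negPf m0; pose E00 : M s := delta_mx 0 0.
  have : ein E l *m eout D k *m E00 = E00 *m (ein E l *m eout D k).
    by rewrite -mulmxA -emb_eout DE mulmxA ein_emb mulmxA.
  move/matrixP/(_ m 0); rewrite [LHS]mxE [RHS]mxE (bigD1 0) //=.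
  rewrite big1 => [|j /negPf j0].
    rewrite big1 => [|j _]; rewrite [E00 _ _]mxE ?m0 ?mul0r //.
    by rewrite !eqxx mulr1 addr0.
  by rewrite [E00 _ _]mxE j0 mulr0.
have ab k k' : \sum_l a k l * b l k' = (k == k')%:R.
  have : ein D k *m (\sum_l eout E l *m ein E l) *m eout D k' = (k == k')%:R%:M.
    by rewrite eoutK mulmx1 einK.
  move/matrixP/(_ 0 0); rewrite [RHS]mxE eqxx mulr1n => <-.
  rewrite mulmx_sumr mulmx_suml summxE; apply: eq_bigr => l _.
  rewrite -!mulmxA mulmxA mxE (bigD1 0) //= big1 ?addr0 // => m m0.
  by rewrite b_col // mulr0.
have a_deg k l : a k l != 0 -> edeg D k = edeg E l.
  by case/mulmx_neq0=> i /ein_deg Dk /eout_deg; rewrite Dk => /mulgI.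
pose I := [set k | edeg D k == g]; pose J := [set l | edeg E l == g].
pose A := \matrix_(p < #|I|, q < #|J|) a (enum_val p) (enum_val q).
pose B := \matrix_(q < #|J|, p < #|I|) b (enum_val q) (enum_val p).
suff /mulmx1_min : A *m B = 1%:M by [].
apply/matrixP=> p p'; rewrite !mxE -(inj_eq enum_val_inj) -ab.
under eq_bigr do rewrite !mxE.
rewrite -(big_enum_val (fun l => a (enum_val p) l * b l (enum_val p'))) /=.
rewrite [LHS]big_mkcond; apply: eq_bigr => l _; rewrite inE.
case: eqP => // lg; have [->|/a_deg al] := eqVneq (a (enum_val p) l) 0.
  by rewrite mul0r.
by case: lg; rewrite -al; have := enum_valP p; rewrite inE => /eqP.
Qed.

Lemma emb_mult_uniq s t (D E : mxemb s t) :
  emb_fun D =1 emb_fun E -> emb_mult D = emb_mult E.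
Proof.
move=> DE; apply/ffunP=> g; apply/eqP.
by rewrite eqn_leq !emb_mult_le // => X; rewrite DE.
Qed.

(** Both sides are multiplicities of an embedding of M_1 in M_t, one direct and one
through M_s, and there is only one unital homomorphism from M_1 to M_t. *)
Lemma degmult_emb s t (E : mxemb s t) : degmult t = degmult s * emb_mult E.
Proof.
rewrite -(emb_unit_mult t) -(emb_unit_mult s) -emb_comp_mult.
apply: emb_mult_uniq => X; rewrite emb_comp_fun (mx11_scalar X).
by rewrite -[_%:M]scalemx1 !linearZ /= !emb_fun1.
Qed.

(** Index the copies of F^s in F^r by pairs (k, w), k being the index of a copy of
F^s in F^t, by a bijection f preserving degrees.  For each w the copies of index
(k, w), glued together as those of index k are in F^t, form a copy of F^t; the
resulting embedding of M_t in M_r restricts to I along D. *)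
Lemma emb_lift s t r (D : mxemb s t) (I : mxemb s r) (w : grpalg nat gT) :
  emb_mult I = emb_mult D * w ->
  exists2 E : mxemb t r, emb_mult E = w &
    forall X, emb_fun E (emb_fun D X) = emb_fun I X.
Proof.
have [W [d <-]] := dcount_realize w.
rewrite /emb_mult -dcountM => /esym/dcount_bij[f [f' [fK f'K fd]]].
pose out (w : W) := \sum_k eout I (f (k, w)) *m ein D k.
pose in_ (w : W) := \sum_k eout D k *m ein I (f (k, w)).
have in_out w1 w2 : in_ w1 *m out w2 = (w1 == w2)%:R%:M.
  rewrite /in_ mulmx_suml; under eq_bigr => k _.
    rewrite /out mulmx_sumr (bigD1 k) //= big1 ?addr0 => [|l /negPf lk].
      rewrite -mulmxA [_ *m (eout I _ *m _)]mulmxA einK (can_eq fK) xpair_eqE eqxx.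
      rewrite mul_scalar_mx -scalemxAr.
      over.
    rewrite -mulmxA [_ *m (eout I _ *m _)]mulmxA einK (can_eq fK) xpair_eqE.
    by rewrite eq_sym lk mul_scalar_mx scale0r mulmx0.
  by rewrite -scaler_sumr eoutK scalemx1.
have out_in (X : M s) : \sum_w out w *m emb_fun D X *m in_ w = emb_fun I X.
  rewrite /emb_fun (reindex f) /=; last by exists f' => x _.
  pose G k w := eout I (f (k, w)) *m X *m ein I (f (k, w)).
  transitivity (\sum_p G p.1 p.2); last by apply: eq_bigr => -[].
  rewrite -(pair_bigA _ G).
  rewrite exchange_big /=; apply: eq_bigr => v _.
  rewrite -/(emb_fun D X) /out !mulmx_suml; apply: eq_bigr => k _.
  rewrite -[_ *m ein D k *m _]mulmxA ein_emb /in_ mulmx_sumr (bigD1 k) //=.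
  rewrite big1 => [|l lk].
    by rewrite addr0 !mulmxA -[_ *m ein D k *m _]mulmxA einK eqxx mulmx1.
  rewrite !mulmxA -[_ *m ein D k *m _]mulmxA einK eq_sym (negPf lk).
  by rewrite mul_mx_scalar scale0r mul0mx.
have out1 : \sum_w out w *m in_ w = 1%:M.
  rewrite -(emb_fun1 I) -out_in; apply: eq_bigr => v _.
  by rewrite emb_fun1 mulmx1.
have out_deg v i j : out v i j != 0 -> r i = (t j * d v)%g.
  rewrite summxE => /sum_neq0[k /mulmx_neq0[l /eout_deg-> /ein_deg->]].
  by rewrite fd mulgA.
have in_deg v i j : in_ v j i != 0 -> r i = (t j * d v)%g.
  rewrite summxE => /sum_neq0[k /mulmx_neq0[l /eout_deg-> /ein_deg->]].
  by rewrite fd mulgA.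
by exists (MxEmb in_out out1 out_deg in_deg).
Qed.

End Embeddings.

(** * Graded matrix units come from embeddings *)

Section Idempotent.

Variables (F : fieldType) (gT : finGroupType) (t : degtuple gT).
Local Notation M s := 'M[F]_((dpred s).+1).

(** An idempotent of trivial degree commutes with the projection Pi g of F^t on the
coordinates of degree g, so it is the sum of the orthogonal idempotents P Pi_g.
A full-rank factorization C R of each of them has R C = 1; the columns of C and
the rows of R are the required homogeneous vectors. *)
Lemma homogeneous_idempotent (P : M t) : P *m P = P -> mxcomp (s := t) 1%g P ->
  exists (K : finType) (d : K -> gT)
    (x : K -> 'cV[F]_((dpred t).+1)) (y : K -> 'rV[F]_((dpred t).+1)),
  [/\ forall k l, y k *m x l = (k == l)%:R%:M,
      \sum_k x k *m y k = P,
      forall k i, x k i 0 != 0 -> t i = d k &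
      forall k i, y k 0 i != 0 -> t i = d k].
Proof.
move=> PP P1; pose Pi g : M t := \matrix_(i, j) ((i == j) && (t i == g))%:R.
have PiL g m (X : 'M_(_, m)) i j : (Pi g *m X) i j = (t i == g)%:R * X i j.
  rewrite mxE (bigD1 i) //= big1 ?addr0 => [|k /negPf ki]; rewrite mxE ?eqxx //.
  by rewrite eq_sym ki mul0r.
have PiR g m (X : 'M_(m, _)) i j : (X *m Pi g) i j = X i j * (t j == g)%:R.
  rewrite mxE (bigD1 j) //= big1 ?addr0 => [|k /negPf kj]; rewrite mxE ?eqxx //.
  by rewrite kj mulr0.
have PPi g : P *m Pi g = Pi g *m P.
  apply/matrixP=> i j; rewrite PiL PiR mulrC.
  have [->|/P1/eqP] := eqVneq (P i j) 0; first by rewrite !mulr0.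
  by rewrite -eq_mulgV1 => /eqP->.
have PiPi g h : Pi g *m Pi h = (g == h)%:R *: Pi g.
  apply/matrixP=> i j; rewrite PiL !mxE; have [->|_] := eqVneq (t i) g.
    by rewrite mul1r; case: (i == j); case: (g == h); rewrite ?eqxx /= ?(mul1r, mul0r).
  by rewrite andbF mulr0 mul0r.
pose Q g := P *m Pi g.
have QQ g h : Q g *m Q h = (g == h)%:R *: Q g.
  rewrite /Q (PPi h) mulmxA -(mulmxA P) PiPi -scalemxAr -scalemxAl.
  by rewrite -mulmxA -PPi mulmxA PP.
have sumQ : \sum_g Q g = P.
  rewrite -mulmx_sumr -[RHS]mulmx1; congr (_ *m _).
  apply/matrixP=> i j; rewrite summxE (bigD1 (t i)) //= big1 => [|g /negPf gt].
    by rewrite !mxE eqxx andbT addr0.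
  by rewrite mxE [t i == g]eq_sym gt andbF.
pose C g := col_base (Q g); pose R g := row_base (Q g).
have CR g : C g *m R g = Q g by exact: mulmx_base.
have Rinj g m (X Y : 'M_(m, _)) : X *m R g = Y *m R g -> X = Y.
  exact: row_free_inj (row_base_free (Q g)) _ _.
have Cinj g p (X Y : 'M_(_, p)) : C g *m X = C g *m Y -> X = Y.
  exact: row_full_inj (col_base_full (Q g)) _ _.
have RCd g : R g *m C g = 1%:M.
  apply: (Cinj g); apply: (Rinj g).
  by rewrite mulmxA CR -mulmxA CR QQ eqxx scale1r mulmx1 CR.
have RC0 g h : g != h -> R g *m C h = 0.
  move=> /negPf gh; apply: (Cinj g); apply: (Rinj h).
  by rewrite mulmxA CR -mulmxA CR QQ gh scale0r mulmx0 mul0mx.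
have Cdeg g i q : C g i q != 0 -> t i = g.
  have <- : Pi g *m C g = C g.
    by apply: (Rinj g); rewrite -mulmxA CR /Q PPi mulmxA PiPi eqxx scale1r.
  by rewrite PiL; case: (t i =P g) => //; rewrite mul0r eqxx.
have Rdeg g q i : R g q i != 0 -> t i = g.
  have <- : R g *m Pi g = R g.
    by apply: (Cinj g); rewrite mulmxA CR /Q -mulmxA PiPi eqxx scale1r.
  by rewrite PiR; case: (t i =P g) => //; rewrite mulr0 eqxx.
exists {g : gT & 'I_(\rank (Q g))}, (fun k => tag k),
  (fun k => col (tagged k) (C (tag k))), (fun k => row (tagged k) (R (tag k))).
split=> [[g q] [h r] /= | | [g q] i /= | [g q] i /=].
- apply/matrixP=> i j; rewrite !ord1 {i j}.
  have -> : (row q (R g) *m col r (C h)) 0 0 = (R g *m C h) q r.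
    by rewrite !mxE; apply: eq_bigr => i _; rewrite !mxE.
  rewrite [RHS]mxE mulr1n; have [gh|gh] := eqVneq g h.
    by subst h; rewrite RCd mxE eq_Tagged.
  by rewrite RC0 // mxE -tag_eqE /tag_eq /= (negPf gh).
- rewrite -[RHS]sumQ; rewrite -(@sig_big_dep _ _ _ _ (fun g => 'I_(\rank (Q g)))
    xpredT (fun _ => xpredT) (fun g q => col q (C g) *m row q (R g))) /=.
  apply: eq_bigr => g _; rewrite -[RHS]CR; apply/matrixP=> i j.
  rewrite summxE [RHS]mxE; apply: eq_bigr => q _.
  by rewrite mxE big_ord1 !mxE.
- by rewrite mxE; exact: Cdeg.
- by rewrite mxE; exact: Rdeg.
Qed.

Variable s : degtuple gT.

(** The analogue of the Skolem-Noether theorem for systems of graded matrix units.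
The image of U_00 has a homogeneous basis (x_k), which is transported by the U_j0
to bases of the images of the U_jj; the j-th column of u_k is U_j0 x_k. *)
Lemma emb_of_units (U : 'I_(dpred s).+1 -> 'I_(dpred s).+1 -> M t) :
    (forall a b c d, U a b *m U c d = (b == c)%:R *: U a d) ->
    \sum_a U a a = 1%:M ->
    (forall a b, mxcomp (s := t) (s a * (s b)^-1)%g (U a b)) ->
  exists E : mxemb F s t, forall a b, emb_fun E (delta_mx a b) = U a b.
Proof.
move=> UM U1 Udeg; pose P := U 0 0.
have [||K [d [x [y [yx xy xdeg ydeg]]]]] := @homogeneous_idempotent P.
- by rewrite UM eqxx scale1r.
- by rewrite -(mulgV (s 0)); exact: Udeg.
pose out k : 'M[F]_((dpred t).+1, (dpred s).+1) :=
  \matrix_(i, j) (U j 0 *m x k) i 0.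
pose in_ k : 'M[F]_((dpred s).+1, (dpred t).+1) :=
  \matrix_(j, i) (y k *m U 0 j) 0 i.
have col_out k j : col j (out k) = U j 0 *m x k.
  by apply/matrixP=> i i'; rewrite !mxE !ord1.
have row_in k j : row j (in_ k) = y k *m U 0 j.
  by apply/matrixP=> i i'; rewrite !mxE !ord1.
have yPx k l : y k *m P *m x l = (k == l)%:R%:M.
  rewrite -xy mulmx_sumr mulmx_suml (bigD1 l) //= big1 ?addr0 => [|m ml].
    by rewrite !mulmxA yx -mulmxA yx eqxx mulmx1.
  by rewrite -!mulmxA yx (negPf ml) mul_mx_scalar scale0r !mulmx0.
have in_out k l : in_ k *m out l = (k == l)%:R%:M.
  apply/matrixP=> j j'.
  have -> : (in_ k *m out l) j j' = (row j (in_ k) *m col j' (out l)) 0 0.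
    by rewrite !mxE; apply: eq_bigr => i _; rewrite !mxE.
  rewrite row_in col_out mulmxA -(mulmxA _ (U 0 j)) UM -scalemxAr -scalemxAl yPx.
  rewrite !mxE eqxx mulr1n; case: (j == j').
    by rewrite mul1r mulr1n.
  by rewrite mul0r mulr0n.
have out_in a b : \sum_k out k *m delta_mx a b *m in_ k = U a b.
  transitivity (\sum_k U a 0 *m (x k *m y k) *m U 0 b).
    apply: eq_bigr => k _; rewrite -(mul_delta_mx (0 : 'I_1)) mulmxA -colE.
    by rewrite -mulmxA -rowE col_out row_in !mulmxA.
  by rewrite -mulmx_suml -mulmx_sumr xy /P UM eqxx scale1r UM eqxx scale1r.
have out1 : \sum_k out k *m in_ k = 1%:M.
  rewrite -U1; under [RHS]eq_bigr do rewrite -out_in.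
  rewrite exchange_big /=; apply: eq_bigr => k _.
  rewrite -mulmx_suml -mulmx_sumr; congr (_ *m _).
  rewrite -[LHS]mulmx1; congr (_ *m _); apply/matrixP=> i j.
  rewrite summxE (bigD1 i) //= big1 => [|a /negPf ai]; rewrite !mxE.
    by rewrite eqxx addr0 [j == i]eq_sym.
  by rewrite [i == a]eq_sym ai.
(* U_j0 has degree s_j / s_0, so the shift of the k-th copy is d_k / s_0. *)
have out_deg k i j : out k i j != 0 -> t i = (s j * ((s 0)^-1 * d k))%g.
  rewrite mxE => /mulmx_neq0[l /Udeg Uil /xdeg <-].
  by rewrite mulgA -Uil mulgKV.
have in_deg k i j : in_ k j i != 0 -> t i = (s j * ((s 0)^-1 * d k))%g.
  rewrite mxE => /mulmx_neq0[l /ydeg <- /Udeg Uil].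
  have := congr1 (fun g => g^-1)%g Uil.
  by rewrite !invMg !invgK => Uli; rewrite mulgA -Uli mulgKV.
exists (MxEmb in_out out1 out_deg in_deg); exact: out_in.
Qed.

End Idempotent.

(** * The stages of the direct limit *)

Section Limit.

Variables (F : fieldType) (gT : finGroupType).
Local Notation M s := 'M[F]_((dpred s).+1).

Section Inclusions.

Variables (x0 : grpalg nat gT) (a : nat -> grpalg nat gT).
Hypothesis a_neq0 : forall i, a i != 0.
Local Notation dg := (chain_degs x0 a).

Definition chain_map n : gradedHom (Mdeg F (dg n)) (Mdeg F (dg n.+1)) :=
  tens1_hom F (dg n) (degs_of (a n)).

Definition inM n (X : M (dg n)) : Minf F x0 a :=
  @dlim_in F (fun n => Mdeg F (dg n)) chain_map n X.

Definition trM m k (X : M (dg m)) : M (dg k) :=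
  @dtrans F (fun n => Mdeg F (dg n)) chain_map m X k.

Lemma inMP n c X Y : inM (c *: X + Y) = c *: inM X + inM (n := n) Y.
Proof. by rewrite /inM linearP. Qed.

Lemma inMM n X Y : inM (X *m Y) = inM X * inM (n := n) Y.
Proof. by rewrite /inM -rmorphM. Qed.

Lemma inM1 n : inM (1%:M : M (dg n)) = 1.
Proof. by rewrite /inM -[RHS](rmorph1 (@dlim_in F _ chain_map n)). Qed.

HB.instance Definition _ n := GRing.isLinear.Build F (M (dg n)) (Minf F x0 a) *:%R
  (@inM n) (@inMP n).

(** The connecting maps X |-> X *t 1 are embeddings of multiplicity a_l, and these
multiply along the chain.  In particular connecting maps are injective. *)
Lemma chain_emb m k : (m <= k)%N ->
  exists2 E : mxemb F (dg m) (dg k), emb_mult E = \prod_(m <= l < k) a l &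
    forall X, emb_fun E X = trM k X.
Proof.
elim: k => [|k IHk].
  rewrite leqn0 => /eqP m0; subst m; exists (emb_id F (dg 0)) => [|X].
    by rewrite emb_id_mult big_geq.
  by rewrite emb_id_fun /trM dtrans_id.
rewrite leq_eqVlt => /predU1P[Dm|lemk].
  subst m; exists (emb_id F (dg k.+1)) => [|X].
    by rewrite emb_id_mult big_geq.
  by rewrite emb_id_fun /trM dtrans_id.
have [E Emult Efun] := IHk lemk.
exists (emb_comp E (emb_tens F (dg k) (degs_of (a k)))) => [|X].
  by rewrite emb_comp_mult Emult emb_tens_mult degs_ofK // big_nat_recr.
by rewrite emb_comp_fun emb_tens_fun Efun /trM dtransS.
Qed.

Lemma inM_tr m k (X : M (dg m)) : (m <= k)%N -> inM (trM k X) = inM X.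
Proof. exact: dlim_in_trans. Qed.

Lemma inM_inj n : injective (@inM n).
Proof.
move=> X Y /dlim_inP[k [nk _ XY]].
have [E _ EX] := chain_emb nk.
by apply: (@emb_fun_inj _ _ _ _ E); rewrite !EX.
Qed.

Lemma inM_surj u : exists n X, u = @inM n X.
Proof. exact: dlim_in1. Qed.

(** An element of the limit may become homogeneous only at a later stage, but
embeddings reflect homogeneity. *)
Lemma inM_gcomp g n (X : M (dg n)) : gcomp g (inM X) <-> mxcomp (s := dg n) g X.
Proof.
split=> [[m [Y [gY XY]]] | gX]; last by exists n, X.
have [E _ EX] := chain_emb (leq_maxl n m).
have [D _ DY] := chain_emb (leq_maxr n m).
apply/(emb_fun_graded E).
suff -> : emb_fun E X = emb_fun D Y by apply/emb_fun_graded.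
by rewrite EX DY; apply: inM_inj; rewrite !inM_tr ?leq_maxl ?leq_maxr.
Qed.

End Inclusions.
End Limit.

(** * Homomorphisms of limits restricted to stages *)

Section Represent.

Variables (F : fieldType) (gT : finGroupType).
Local Notation M s := 'M[F]_((dpred s).+1).

Definition represents (x y : grpalg nat gT) (a b : nat -> grpalg nat gT) i k
    (f : Minf F x a -> Minf F y b)
    (E : mxemb F (chain_degs x a i) (chain_degs y b k)) :=
  forall X, f (inM X) = inM (emb_fun E X).

Lemma linear_delta_ext m n (V : lmodType F) (f g : {linear 'M[F]_(m, n) -> V}) :
  (forall i j, f (delta_mx i j) = g (delta_mx i j)) -> f =1 g.
Proof.
move=> fg X; rewrite [X]matrix_sum_delta !linear_sum; apply: eq_bigr => i _.
by rewrite !linear_sum; apply: eq_bigr => j _; rewrite !linearZ /= fg.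
Qed.

Lemma represents_mult (x y : grpalg nat gT) (a b : nat -> grpalg nat gT) i k
    (f : Minf F x a -> Minf F y b)
    (E D : mxemb F (chain_degs x a i) (chain_degs y b k)) :
  (forall l, b l != 0) -> represents f E -> represents f D ->
  emb_mult E = emb_mult D.
Proof.
move=> b0 fE fD; apply: emb_mult_uniq => X.
by apply: (inM_inj b0); rewrite -fE -fD.
Qed.

Lemma represents_comp (x y z : grpalg nat gT) (a b c : nat -> grpalg nat gT) i k l
    (f : Minf F x a -> Minf F y b) (g : Minf F y b -> Minf F z c)
    (D : mxemb F (chain_degs x a i) (chain_degs y b k))
    (E : mxemb F (chain_degs y b k) (chain_degs z c l)) :
  represents f D -> represents g E -> represents (g \o f) (emb_comp D E).
Proof. by move=> fD gE X; rewrite /= fD gE emb_comp_fun. Qed.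

Lemma represents_chain (x : grpalg nat gT) (a : nat -> grpalg nat gT) i k :
    (forall l, a l != 0) -> (i <= k)%N ->
  exists2 E : mxemb F (chain_degs x a i) (chain_degs x a k),
    emb_mult E = \prod_(i <= l < k) a l & represents idfun E.
Proof.
move=> a0 leik; have [E Emult Etr] := chain_emb F x a0 leik; exists E => // X.
by rewrite Etr inM_tr.
Qed.

(** The images of the matrix units of the i-th stage are homogeneous, and all of them
live at some stage N; they satisfy there the relations of matrix units since the
stages embed in the limit. *)
Lemma represents_exists (x y : grpalg nat gT) (a b : nat -> grpalg nat gT)
    (f : gradedHom (Minf F x a) (Minf F y b)) i :
    (forall l, a l != 0) -> (forall l, b l != 0) ->
  exists N, forall k, (N <= k)%N ->
    exists E : mxemb F (chain_degs x a i) (chain_degs y b k), represents f E.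
Proof.
move=> a0 b0; set s := chain_degs x a i.
have /choice[N NP] (p : 'I_(dpred s).+1 * 'I_(dpred s).+1) :
    exists N, forall k, (N <= k)%N ->
    exists2 Y : M (chain_degs y b k),
      mxcomp (s := chain_degs y b k) (s p.1 * (s p.2)^-1)%g Y &
      f (inM (delta_mx p.1 p.2 : M s)) = inM Y.
  have: gcomp (s p.1 * (s p.2)^-1)%g (f (inM (delta_mx p.1 p.2 : M s))).
    apply: ghomP; apply/inM_gcomp => // j j'; rewrite mxE.
    have [->|_] := eqVneq j p.1; last by rewrite eqxx.
    by have [->|_] := eqVneq j' p.2; last rewrite eqxx.
  by move/glim_comp_ge.
exists (\max_p N p) => k kN.
have /choice[U UP] (p : 'I_(dpred s).+1 * 'I_(dpred s).+1) :
    exists Y : M (chain_degs y b k),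
    mxcomp (s := chain_degs y b k) (s p.1 * (s p.2)^-1)%g Y /\
    f (inM (delta_mx p.1 p.2 : M s)) = inM Y.
  have [|Y gY fY] := NP p k; last by exists Y.
  by apply: leq_trans kN; exact: leq_bigmax.
have Uf c d : f (inM (delta_mx c d : M s)) = inM (U (c, d)) by have [] := UP (c, d).
have [| | |E EU] := @emb_of_units F gT (chain_degs y b k) s (fun c d => U (c, d)).
- move=> c d c' d'; apply: (inM_inj b0).
  rewrite inMM -!Uf -rmorphM -inMM mul_delta_mx_cond linearZ /= -Uf.
  by case: eqP => _; rewrite ?mulr1n ?mulr0n ?scale1r ?scale0r ?linear0 // raddf0.
- apply: (inM_inj b0); rewrite linear_sum inM1 -(rmorph1 f) -(inM1 F x a i).
  rewrite [1%:M]matrix_sum_delta !linear_sum /= (raddf_sum f).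
  apply: eq_bigr => c _; rewrite linear_sum /= (raddf_sum f).
  rewrite (bigD1 c) //= big1 => [|d /negPf dc].
    by rewrite addr0 mxE eqxx scale1r Uf.
  by rewrite mxE eq_sym dc scale0r linear0 raddf0.
- by move=> c d; have [] := UP (c, d).
exists E; apply: (linear_delta_ext (f := f \o @inM F gT x a i : {linear _ -> _})
  (g := @inM F gT y b k \o emb_fun E : {linear _ -> _})) => c d /=.
by rewrite Uf EU.
Qed.

End Represent.

(** * Graded isomorphisms given by their graphs *)

Section GradedHomOfRelation.

Variables (F : fieldType) (gT : finGroupType) (A B : gradedAlg F gT).

(** Stated for graphs because the isomorphism below is constructed as an increasing
union of maps between stages. *)
Lemma gradedHom_of_rel (R : A -> B -> Prop) :
    (forall u, exists v, R u v) -> (forall u v v', R u v -> R u v' -> v = v') ->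
    R 1 1 ->
    (forall c u u' v v', R u v -> R u' v' -> R (c *: u + u') (c *: v + v')) ->
    (forall u u' v v', R u v -> R u' v' -> R (u * u') (v * v')) ->
    (forall g u v, R u v -> gcomp g u -> gcomp g v) ->
  exists f : gradedHom A B, forall u, R u (f u).
Proof.
move=> /choice[f fR] R_fun R1 RD RM Rg.
have f_lin : linear f by move=> c u v; apply: R_fun (fR _) _; apply: RD.
have f_mon : monoid_morphism f.
  split=> [|u v]; first exact: R_fun (fR _) R1.
  by apply: R_fun (fR _) _; apply: RM.
pose fL := GRing.isLinear.Build F A B *:%R f f_lin.
pose fM := GRing.isMonoidMorphism.Build A B f f_mon.
pose h : {lrmorphism A -> B} := HB.pack f fL fM.
have hg g u : gcomp g u -> gcomp g (h u) by exact: Rg (fR u).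
by exists (GradedHom hg).
Qed.

End GradedHomOfRelation.

Lemma graded_iso_of_rel (F : fieldType) (gT : finGroupType) (A B : gradedAlg F gT)
    (R : A -> B -> Prop) :
    (forall u, exists v, R u v) -> (forall v, exists u, R u v) ->
    (forall u u' v v', R u v -> R u' v' -> u = u' <-> v = v') ->
    R 1 1 ->
    (forall c u u' v v', R u v -> R u' v' -> R (c *: u + u') (c *: v + v')) ->
    (forall u u' v v', R u v -> R u' v' -> R (u * u') (v * v')) ->
    (forall g u v, R u v -> gcomp g u <-> gcomp g v) ->
  graded_iso A B.
Proof.
move=> Rl Rr Rinj R1 RD RM Rg.
have [f fR] : exists f : gradedHom A B, forall u, R u (f u).
  by apply: gradedHom_of_rel => // [u v v' /Rinj uv /uv[->]|g u v /Rg->].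
have [h hR] : exists h : gradedHom B A, forall v, R (h v) v.
  apply: (gradedHom_of_rel (R := fun v u => R u v)) => //.
  - by move=> v u u' /Rinj vu /vu[_ ->].
  - by move=> c u u' v v'; apply: RD.
  - by move=> u u' v v'; apply: RM.
  - by move=> g v u /Rg->.
by exists f, h; split=> u; [have [_ ->] := Rinj _ _ _ _ (hR (f u)) (fR u)
  | have [->] := Rinj _ _ _ _ (fR (h u)) (hR u)].
Qed.

(** * Divisibilities from an isomorphism *)

Section Isomorphism.

Variables (F : fieldType) (gT : finGroupType).
Hypothesis abG : abelian [set: gT].
Implicit Types (x y : grpalg nat gT) (a b : nat -> grpalg nat gT) (chi : gdual gT).

Section IsoImplies.

Variables (x0 y0 : grpalg nat gT) (a b : nat -> grpalg nat gT).
Variables (S T : {set {set gdual gT}}).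
Hypotheses (a0 : forall i, a i != 0) (b0 : forall i, b i != 0).
Hypothesis aS : forall i, supp (ratG (a i)) = S.
Hypothesis bT : forall i, supp (ratG (b i)) = T.
Variables (f : gradedHom (Minf F x0 a) (Minf F y0 b)).
Variables (g : gradedHom (Minf F y0 b) (Minf F x0 a)).
Hypothesis fK : cancel f g.

(** Both sides are the multiplicity of the inclusion of the i-th stage in the j-th
one. *)
Lemma iso_mult i k j (D : mxemb F (chain_degs x0 a i) (chain_degs y0 b k))
    (E : mxemb F (chain_degs y0 b k) (chain_degs x0 a j)) :
  (i <= j)%N -> represents f D -> represents g E ->
  emb_mult D * emb_mult E = \prod_(i <= l < j) a l.
Proof.
move=> leij fD gE; have [I <- idI] := represents_chain F x0 a0 leij.
rewrite -emb_comp_mult; apply: (represents_mult (f := idfun) a0) => //.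
by move=> X; rewrite /= emb_comp_fun -gE -fD fK.
Qed.

(** By [iso_mult] the multiplicity of D divides a partial product of a.  The target
stage comes after one that f already reaches, so that this multiplicity is also
divisible by a factor of the second tower. *)
Lemma iso_start : exists k (D : mxemb F (chain_degs x0 a 0) (chain_degs y0 b k.+1)),
  [/\ represents f D,
      forall chi, gal_orbit chi \in S -> evn chi (emb_mult D) != 0 &
      forall chi, evn chi (emb_mult D) != 0 -> gal_orbit chi \in T].
Proof.
have [N NP] := represents_exists f 0 a0 b0.
have [D fD] := NP N (leqnn N); have [D' fD'] := NP N.+1 (leqnSn N).
exists N, D'; split=> // chi oS.
  have [m mP] := represents_exists g N.+1 b0 a0.
  have [E gE] := mP m.+1 (leqnSn m).
  have := iso_mult (leq0n _) fD' gE; rewrite big_mkord => DE.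
  have := partprod_neq0 abG m.+1 aS oS; rewrite /partprod -DE evnM mulf_eq0 negb_or.
  by case/andP.
have [I Imult idI] := represents_chain F y0 b0 (leqnSn N).
rewrite big_nat1 in Imult; rewrite (mem_suppn abG chi (bT N)); move: oS.
have -> : emb_mult D' = emb_mult D * b N.
  rewrite -Imult -emb_comp_mult.
  apply: (represents_mult (f := f) b0) => //.
  exact: (represents_comp (g := idfun)).
by rewrite evnM mulf_eq0 negb_or => /andP[].
Qed.

Lemma iso_supp_sub : S \subset T.
Proof.
have [k [D [_ DS DT]]] := iso_start.
apply/fintype.subsetP=> j jS.
have := fintype.subsetP (supp_orbits (ratG (a 0%N))) j.
rewrite aS => /(_ jS)/imsetP[chi _ Dj]; rewrite Dj.
by apply/DT/DS; rewrite -Dj.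
Qed.

End IsoImplies.

(** The witnesses are the multiplicity c of the restriction of f from stage 0 to a
stage K, and d = B_K.  If w and w' are the multiplicities of the restrictions of
f from stage i to k and of g from stage k to j, then c B_k = d A_i w and
d A_j = c B_k w'. *)
Lemma cofinal_of_iso (x0 y0 : grpalg nat gT) (a b : nat -> grpalg nat gT)
    (S T : {set {set gdual gT}})
    (f : gradedHom (Minf F x0 a) (Minf F y0 b))
    (g : gradedHom (Minf F y0 b) (Minf F x0 a)) :
    x0 != 0 -> y0 != 0 -> (forall i, a i != 0) -> (forall i, b i != 0) ->
    (forall i, supp (ratG (a i)) = S) -> (forall i, supp (ratG (b i)) = T) ->
    cancel f g -> cancel g f ->
  S = T /\ exists c d : grpalg nat gT,
    [/\ supp (ratG c) = S, supp (ratG d) = S, c * x0 = d * y0,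
        cofinal c d a b & cofinal d c b a].
Proof.
move=> x00 y00 a0 b0 aS bT fK gK.
have ST : S = T.
  apply/eqP; rewrite finset.eqEsubset (iso_supp_sub a0 b0 aS bT fK).
  exact: (iso_supp_sub b0 a0 bT aS gK).
have [K' [D [fD DS DT]]] := iso_start a0 b0 aS bT fK.
pose K := K'.+1; rewrite -ST in DT bT.
have SP : S \subset gal_orbits gT by rewrite -(aS 0%N) supp_orbits.
have extD k (leKk : (K <= k)%N) :
    exists2 D' : mxemb F (chain_degs x0 a 0) (chain_degs y0 b k),
    represents f D' & emb_mult D' = emb_mult D * \prod_(K <= l < k) b l.
  have [I Imult idI] := represents_chain F y0 b0 leKk.
  exists (emb_comp D I); last by rewrite emb_comp_mult Imult.
  exact: (represents_comp (g := idfun)).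
split=> //; exists (emb_mult D), (partprod b K); split.
- by apply: suppE => // chi; apply/idP/idP => [/DS|/DT].
- apply: suppE => // chi; apply/idP/idP => [|]; first exact: partprod_neq0.
  rewrite partprodS -[evQ _ _]/(evn _ _) evnM mulf_eq0 negb_or => /andP[_].
  by rewrite -(mem_suppn abG chi (bT K')).
- have := degmult_emb D; rewrite !chain_degsE // big_ord0 mulr1 => xD.
  by rewrite grpalg_mulC // -xD; exact: grpalg_mulC.
- move=> i; have [N NP] := represents_exists f i a0 b0.
  have [E fE] := NP (maxn N K) (leq_maxl _ _).
  have [D' fD' D'mult] := extD (maxn N K) (leq_maxr _ _).
  have [I Imult idI] := represents_chain F x0 a0 (leq0n i).
  have DE : emb_mult D' = partprod a i * emb_mult E.
    rewrite /partprod -(big_mkord xpredT) -Imult -emb_comp_mult.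
    by apply: (represents_mult b0 fD'); apply: (represents_comp (f := idfun)).
  exists (maxn N K), (emb_mult E).
  rewrite (partprod_cat b (leq_maxr N K)) -mulrA -DE D'mult !mulrA; congr (_ * _).
  exact: grpalg_mulC.
- move=> k; have [D' fD' D'mult] := extD (maxn k K) (leq_maxr _ _).
  have [j jP] := represents_exists g (maxn k K) b0 a0.
  have [E gE] := jP j (leqnn j).
  exists j, (\prod_(k <= l < maxn k K) b l * emb_mult E).
  have := iso_mult a0 fK (leq0n j) fD' gE; rewrite big_mkord -/(partprod a j) => <-.
  have cat : partprod b K * \prod_(K <= l < maxn k K) b l =
      partprod b k * \prod_(k <= l < maxn k K) b l.
    by rewrite -!partprod_cat ?leq_maxl ?leq_maxr.
  rewrite D'mult; apply: evn_inj => // chi; have := congr1 (evn chi) cat.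
  rewrite !evnM; set P := evn _ (partprod b K); set Q := evn _ (partprod b k).
  set U := evn _ (\prod_(K <= _ < _) _); set V := evn _ (\prod_(k <= _ < _) _).
  set W := evn _ (emb_mult D); set Z := evn _ (emb_mult E) => UV.
  transitivity (P * U * W * Z); first by ring.
  by rewrite UV; ring.
Qed.

End Isomorphism.

(** * An isomorphism from divisibilities *)

Section BackAndForth.

Variables (F : fieldType) (gT : finGroupType).
Hypothesis abG : abelian [set: gT].
Implicit Types (x y : grpalg nat gT) (a b : nat -> grpalg nat gT) (chi : gdual gT).
Variable S : {set {set gdual gT}}.

(** The invariant carried along the ladder.  The equation makes the multiplicity of E
the formal quotient c B_k / (d A_i), which together with the condition on its
support determines the multiplicity of the next rung. *)
Definition calibrated (x y c d : grpalg nat gT) (a b : nat -> grpalg nat gT) i k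
    (E : mxemb F (chain_degs x a i) (chain_degs y b k)) :=
  c * partprod b k = d * partprod a i * emb_mult E /\
  forall chi, evn chi (emb_mult E) != 0 -> gal_orbit chi \in S.

Lemma segment_supp a m n chi : (m < n)%N -> (forall l, supp (ratG (a l)) = S) ->
  evn chi (\prod_(m <= l < n) a l) != 0 -> gal_orbit chi \in S.
Proof.
case: n => // n; rewrite ltnS => lemn aS.
rewrite big_nat_recr //= evnM mulf_eq0 negb_or => /andP[_].
by rewrite -(mem_suppn abG chi (aS n)).
Qed.

(** Multiplying w by a further factor of b forces its support into S and lets k be
arbitrarily large. *)
Lemma cofinal_large c d a b i n : cofinal c d a b ->
    (forall l, supp (ratG (b l)) = S) ->
  exists k w, [/\ (n < k)%N, c * partprod b k = d * partprod a i * w &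
    forall chi, evn chi w != 0 -> gal_orbit chi \in S].
Proof.
move=> /(_ i)[k [w cd]] bS; pose k' := (maxn k n).+1.
exists k', (w * \prod_(k <= l < k') b l); split.
- by rewrite ltnS leq_maxr.
- by rewrite mulrA -cd -mulrA -partprod_cat // leqW // leq_maxl.
move=> chi; rewrite evnM mulf_eq0 negb_or => /andP[_].
by apply: segment_supp => //; rewrite ltnS leq_maxl.
Qed.

(** One more rung of the ladder: divisibility provides w with d A_j = c B_k w, and
cancelling d A_i over S shows that the product of the multiplicity of E by w is
the multiplicity of the connecting map from i to j, so that this map factors
through E. *)
Lemma calibrated_lift x y c d a b i k
    (E : mxemb F (chain_degs x a i) (chain_degs y b k)) :
    (forall l, a l != 0) ->
    (forall l, supp (ratG (a l)) = S) -> supp (ratG d) = S ->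
    cofinal d c b a -> calibrated c d E ->
  exists j (D : mxemb F (chain_degs y b k) (chain_degs x a j)),
    [/\ (i < j)%N, calibrated d c D & forall X, emb_fun D (emb_fun E X) = trM j X].
Proof.
move=> a0 aS dS dom [cdE ES].
have [j [w [ltij dcw wS]]] := cofinal_large k i dom aS.
have [I Imult Ifun] := chain_emb F x a0 (ltnW ltij).
have /emb_lift[D Dw DE] : emb_mult I = emb_mult E * w.
  rewrite Imult; apply: evn_inj => // chi; rewrite evnM.
  have [oS|oS] := boolP (gal_orbit chi \in S); last first.
    have [->|/ES] := eqVneq (evn chi (emb_mult E)) 0; last by rewrite (negPf oS).
    by rewrite mul0r; apply/eqP; apply: contraNT oS; exact: segment_supp.
  apply: (mulfI (evn_neq0 abG dS oS)); apply: (mulfI (partprod_neq0 abG i aS oS)).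
  have := congr1 (evn chi) dcw.
  rewrite cdE (partprod_cat _ (ltnW ltij)) !evnM mulrCA => e.
  by rewrite mulrCA [LHS]mulrCA e; ring.
exists j, D; split=> [//||X]; last by rewrite DE Ifun.
by split; rewrite Dw.
Qed.

(** The first rung has to satisfy y_k = x w; cancelling c in c B_k = d w, after
multiplication by y, gives this identity.  The rung is then obtained by lifting
the embedding of M_1 in M_(y_k) along the one of M_1 in M_x. *)
Lemma calibrated_start x y c d a b :
    y != 0 -> (forall l, b l != 0) ->
    supp (ratG x) \subset S -> supp (ratG y) \subset S ->
    (forall l, supp (ratG (b l)) = S) -> supp (ratG c) = S ->
    c * x = d * y -> cofinal c d a b -> x != 0 ->
  exists k (E : mxemb F (chain_degs x a 0) (chain_degs y b k)), calibrated c d E.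
Proof.
move=> y0 b0 xS yS bS cS cxdy dom x0.
have subS z chi :
    supp (ratG z) \subset S -> gal_orbit chi \notin S -> evn chi z = 0.
  move=> zS; apply: contraNeq => z0; apply: (fintype.subsetP zS).
  by rewrite mem_supp.
have [k [w [_ cdw wS]]] := cofinal_large 0 0 dom bS.
have : emb_mult (emb_unit F (chain_degs y b k)) =
    emb_mult (emb_unit F (chain_degs x a 0)) * w.
  rewrite !emb_unit_mult chain_degsE // [chain_degs x a 0]/(degs_of x) degs_ofK //.
  rewrite -/(partprod b k); apply: evn_inj => // chi; rewrite !evnM.
  have [oS|oS] := boolP (gal_orbit chi \in S); last first.
    by rewrite (subS _ _ xS oS) (subS _ _ yS oS) !mul0r.
  apply: (mulfI (evn_neq0 abG cS oS)).
  have := congr1 (evn chi) cdw; have := congr1 (evn chi) cxdy.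
  rewrite partprod0 mulr1 !evnM => e1 e2.
  by rewrite mulrCA e2 [RHS]mulrA e1; ring.
case/emb_lift=> E Ew _; by exists k, E; split; rewrite Ew.
Qed.

(** Back-and-forth: alternating rungs from the first tower to the second and back
compose to the connecting maps, so that their union is the graph of an
isomorphism. *)
Lemma iso_of_cofinal x y c d a b :
    x != 0 -> y != 0 -> (forall l, a l != 0) -> (forall l, b l != 0) ->
    supp (ratG x) \subset S -> supp (ratG y) \subset S ->
    (forall l, supp (ratG (a l)) = S) -> (forall l, supp (ratG (b l)) = S) ->
    supp (ratG c) = S -> supp (ratG d) = S -> c * x = d * y ->
    cofinal c d a b -> cofinal d c b a ->
  graded_iso (Minf F x a) (Minf F y b).
Proof.
move=> x0 y0 a0 b0 xS yS aS bS cS dS cxdy dom_ab dom_ba.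
(* A state is a downward rung; the step [next] adds the upward rung D and the
   following downward one. *)
pose state :=
  {p : {p : nat * nat & mxemb F (chain_degs x a p.1) (chain_degs y b p.2)} |
  calibrated c d (projT2 p)}.
pose src (t : state) := (projT1 (sval t)).1.
pose tgt (t : state) := (projT1 (sval t)).2.
pose em (t : state) : mxemb F (chain_degs x a (src t)) (chain_degs y b (tgt t)) :=
  projT2 (sval t).
pose next (t u : state) := [/\ (src t < src u)%N, (tgt t < tgt u)%N &
  exists D : mxemb F (chain_degs y b (tgt t)) (chain_degs x a (src u)),
    (forall X, emb_fun D (emb_fun (em t) X) = trM (src u) X) /\
    (forall Y, emb_fun (em u) (emb_fun D Y) = trM (tgt u) Y)].
have [k0 [E0 cE0]] := calibrated_start y0 b0 xS yS bS cS cxdy dom_ab x0.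
pose t0 : state := exist _ (existT _ (0%N, k0) E0) cE0.
have /choice[succ succP] : forall t, exists u, next t u.
  case=> -[[i k] /= E] cE.
  have [j [D [ltij cD DE]]] := calibrated_lift a0 aS dS dom_ba cE.
  have [l [E' [ltkl cE' E'D]]] := calibrated_lift b0 bS cS dom_ab cD.
  exists (exist _ (existT _ (j, l) E') cE'); split=> //.
  by exists D.
pose st n := iter n succ t0.
have stP n : next (st n) (st n.+1) by exact: succP.
have src_ge n : (n <= src (st n))%N.
  by elim: n => // n IHn; have [lt _ _] := stP n; exact: leq_ltn_trans IHn lt.
have tgt_ge n : (n <= tgt (st n))%N.
  by elim: n => // n IHn; have [_ lt _] := stP n; exact: leq_ltn_trans IHn lt.
pose R u v := exists n X, u = inM X /\ v = inM (emb_fun (em (st n)) X).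
pose Rn n u v := exists X, u = inM X /\ v = inM (emb_fun (em (st n)) X).
have Rn_le n m u v : (n <= m)%N -> Rn n u v -> Rn m u v.
  move=> /subnK <-; elim: (m - n)%N => // {}m IHm /IHm[X [-> ->]].
  rewrite addSn; have [lts ltt [D [DE ED]]] := stP (m + n)%N.
  exists (trM (src (st (m + n).+1)) X); rewrite inM_tr ?(ltnW lts) //; split=> //.
  by rewrite -DE ED inM_tr // ltnW.
have R2 u v u' v' : R u v -> R u' v' -> exists n, Rn n u v /\ Rn n u' v'.
  move=> [n Ruv] [m Ruv']; exists (maxn n m).
  split; first by apply: Rn_le Ruv; exact: leq_maxl.
  by apply: Rn_le Ruv'; exact: leq_maxr.
have Rl u : exists v, R u v.
  have [n [X ->]] := inM_surj u; pose X' := trM (src (st n)) X.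
  by exists (inM (emb_fun (em (st n)) X')), n, X'; rewrite inM_tr.
have Rr v : exists u, R u v.
  have [n [Y ->]] := inM_surj v; pose Y' := trM (tgt (st n)) Y.
  have [_ ltt [D [DE ED]]] := stP n.
  exists (inM (emb_fun D Y')), n.+1, (emb_fun D Y'); split=> //.
  by rewrite ED !inM_tr // ltnW.
apply: (graded_iso_of_rel (R := R)) => //.
- move=> u u' v v' Ruv /(R2 _ _ _ _ Ruv)[n [[X [-> ->]] [X' [-> ->]]]].
  by split=> [/inM_inj->|/inM_inj/emb_fun_inj->].
- by exists 0%N, 1%:M; rewrite emb_fun1 !inM1.
- move=> e u u' v v' Ruv /(R2 _ _ _ _ Ruv)[n [[X [-> ->]] [X' [-> ->]]]].
  by exists n, (e *: X + X'); rewrite !linearP.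
- move=> u u' v v' Ruv /(R2 _ _ _ _ Ruv)[n [[X [-> ->]] [X' [-> ->]]]].
  by exists n, (X *m X'); rewrite emb_funM !inMM.
move=> g u v [n [X [-> ->]]].
split=> /inM_gcomp Xg; apply/inM_gcomp=> //; apply/emb_fun_graded; exact: Xg.
Qed.

End BackAndForth.

Theorem theorem16 (gT : finGroupType) (F : fieldType)
    (x0 x0' : grpalg nat gT) (a a' : nat -> grpalg nat gT)
    (S S' : {set {set gdual gT}})
    (abG : abelian [set: gT])
    (x0_neq0 : x0 != 0) (a_neq0 : forall i, a i != 0)
    (x0'_neq0 : x0' != 0) (a'_neq0 : forall i, a' i != 0)
    (stdA : standard_form x0 a S) (stdA' : standard_form x0' a' S') :
  graded_iso (Minf F x0 a) (Minf F x0' a') <->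
  S = S' /\
  exists b b' : grpalg nat gT,
    [/\ supp (ratG b) = S, supp (ratG b') = S,
        b * bar x0 = b' * bar x0'
      & [set ratG b * y | y in Kplus S a]%classic =
        [set ratG b' * y | y in Kplus S' a']%classic].
Proof.
have [aS xS] := stdA; have [a'S' x'S'] := stdA'.
have SP : S \subset gal_orbits gT by rewrite -(aS 0%N) supp_orbits.
have supp_bar z : supp (ratG z) = S -> supp (ratG (bar z)) = S.
  move=> zS; apply: suppE => // chi.
  by rewrite (mem_suppn abG chi zS) -[evQ _ _]/(evn _ _) evn_bar_eq0.
split=> [[f [g [fK gK]]] | [ST [b [b' [bS b'S bx eqK]]]]].
  have [ST [c [d [cS dS cxdy dom_ab dom_ba]]]] :=
    cofinal_of_iso abG x0_neq0 x0'_neq0 a_neq0 a'_neq0 aS a'S' fK gK.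
  split=> //; rewrite -ST in a'S' *.
  exists (bar c), (bar d); split; try exact: supp_bar.
    by rewrite -!(barM abG) cxdy.
  apply/seteqP; split; apply/Kplus_leP; rewrite ?(@barK gT) //; exact: supp_bar.
rewrite -ST in a'S' x'S' eqK; have /seteqP[leK geK] := eqK.
apply: (@iso_of_cofinal F gT abG S x0 x0' (bar b) (bar b') a a') => //;
  try exact: supp_bar.
- by rewrite -[x0](@barK gT) -[x0'](@barK gT) -!(barM abG) bx.
- by move=> i; have /Kplus_leP := leK; apply.
- by move=> i; have /Kplus_leP := geK; apply.
Qed.
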